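(* For every integer $z\ge 2$ and all positive integers $n,d$ there are effectively computable constants $T=T(z,n,d)$, $E=E(z,n,d)$ and $L=L(z,n,d)$ such that the following hold for every subvariety $V=Z(f_1,\ldots,f_s)\subset\mathbb{G}_m^n$ defined by polynomials $f_1,\ldots,f_s\in\mathbb{C}[X_1,\ldots,X_n]$ of total degree at most $d$: (i) $S(z,V)=V(z,T)$; (ii) the subvariety $S(z,V)$ is contained in a finite union $\bigcup_i D_i$ of $(n-1)$-dimensional torsion cosets, where $D_i=Z(h)$ with $h\sim \boldsymbol{X}^{\boldsymbol{a}_i}-\zeta_i$, $\boldsymbol a_i\in\mathbb{Z}^n$ with $\|\boldsymbol a_i\|_2\le L$, and $\zeta_i$ a $z^k(z^l-1)$-th root of unity for some integers $k,l$ with $k,l\le E$.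
   Context: $\mathbb{G}_m^n$ is the complex algebraic torus, identified with the Zariski open subset $x_1\cdots x_n\neq 0$ of $\mathbb{A}^n(\mathbb{C})$ with coordinatewise multiplication. A subvariety of $\mathbb{G}_m^n$ means a Zariski closed subset; $Z(f_1,\ldots,f_s)$ denotes the set of common zeros in $\mathbb{G}_m^n$. For an integer $z\ge 2$, the power map is $\phi(x_1,\ldots,x_n)=(x_1^z,\ldots,x_n^z)$. For a Laurent polynomial $f$ write $f^t=f(X_1^{z^t},\ldots,X_n^{z^t})$, and $\boldsymbol X^{\boldsymbol i}=X_1^{i_1}\cdots X_n^{i_n}$. For nonzero Laurent polynomials, $f\sim g$ means $f/g$ is a constant or a monomial. For $V=Z(f_1,\ldots,f_s)$ and an integer $u\ge0$, $V(z,u)=\{\boldsymbol x\in\mathbb{G}_m^n:\phi^t(\boldsymbol x)\in V \text{ for } t=0,\ldots,u\}$, i.e. the subvariety defined by all $f_i^t$, $1\le i\le s$, $0\le t\le u$. A subvariety $S\subset V$ is $(z,V)$-stable if $S\subset V(z,u)$ for all positive integers $u$ (i.e. the forward $\phi$-orbit of every point of $S$ lies in $V$); it is maximal if no $(z,V)$-stable subvariety strictly contains it; the maximal $(z,V)$-stable subvariety is denoted $S(z,V)$. A subtorus is a geometrically irreducible algebraic subgroup of $\mathbb{G}_m^n$; a torsion point is a point all of whose coordinates are roots of unity; a torsion coset is a set $\boldsymbol\omega H$ with $H$ a subtorus and $\boldsymbol\omega$ a torsion point.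
   Formalization: Part (ii) is stated only for V different from the whole torus: if all f_j vanish identically, S(z,V) is all of G_m^n and lies in no finite union of (n-1)-dimensional torsion cosets, so (ii) fails there; part (i) is stated for every V. *)

(* Defs.v *)
From mathcomp Require Import all_boot all_order all_algebra.
From mathcomp Require Import boolp classical_sets reals complex mpoly.

Set Implicit Arguments.
Unset Strict Implicit.
Unset Printing Implicit Defensive.

Import GRing.Theory Num.Theory.

Local Open Scope classical_set_scope.
Local Open Scope ring_scope.

(* "Effectively computable" is rendered by the mu-recursive functions.
   [rprec f g] is primitive recursion on the first argument, with
   g receiving (counter, previous value, parameters); [rmu f] searches for the
   least value of the first argument of f. *)
Inductive recf : nat -> Type :=
| rzero n : recf n
| rsucc : recf 1
| rproj n : 'I_n -> recf n
| rcomp k n : recf k -> ('I_k -> recf n) -> recf n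
| rprec n : recf n -> recf n.+2 -> recf n.+1
| rmu n : recf n.+1 -> recf n.

(* [rgraph f v y]: the partial function denoted by f is defined at v, with
   value y. *)
Fixpoint rgraph (n : nat) (f : recf n) : n.-tuple nat -> nat -> Prop :=
  match f in recf n return n.-tuple nat -> nat -> Prop with
  | rzero n => fun _ y => y = 0%N
  | rsucc => fun v y => y = (thead v).+1
  | rproj n i => fun v y => y = tnth v i
  | rcomp k n f g => fun v y =>
      exists2 w : k.-tuple nat,
        (forall i, rgraph (g i) v (tnth w i)) & rgraph f w y
  | rprec n f g => fun v y =>
      exists s : nat -> nat,
        [/\ rgraph f [tuple of behead v] (s 0%N),
            forall i, (i < thead v)%N ->
              rgraph g [tuple of i :: s i :: behead v] (s i.+1)
          & y = s (thead v)]
  | rmu n f => fun v y =>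
      rgraph f [tuple of y :: v] 0%N /\
      forall i, (i < y)%N -> exists m, rgraph f [tuple of i :: v] m.+1
  end.

Definition computable3 (F : nat -> nat -> nat -> nat) : Prop :=
  exists f : recf 3, forall a b c, rgraph f [tuple a; b; c] (F a b c).

Section Torus.
Variables (R : realType) (n : nat).

Local Notation C := R[i].
Local Notation point := ('I_n -> C).
Implicit Types (V S W H D : set point) (x w : point).

Definition Gm : set point := [set x | forall i, x i != 0].

Definition ptmul x w : point := fun i => x i * w i.
Definition ptinv x : point := fun i => (x i)^-1.
Definition pt1 : point := fun=> 1.

Definition Zset (F : set {mpoly C[n]}) : set point :=
  [set x | Gm x /\ forall f, F f -> f.@[x] = 0].

Definition subvariety W : Prop := exists F, W = Zset F.

Definition power_map (z : nat) x : point := fun i => x i ^+ z.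

Definition Vzu V (z u : nat) : set point :=
  [set x | Gm x /\ forall t, (t <= u)%N -> V (iter t (power_map z) x)].

Definition stable (z : nat) V S : Prop :=
  [/\ subvariety S, S `<=` V & forall u, (0 < u)%N -> S `<=` Vzu V z u].

Definition maximal_stable (z : nat) V S : Prop :=
  stable z V S /\ ~ (exists S', stable z V S' /\ S `<` S').

Definition irreducible_set W : Prop :=
  W !=set0 /\
  forall A B, subvariety A -> subvariety B -> W `<=` A `|` B ->
    W `<=` A \/ W `<=` B.

Definition algebraic_subgroup H : Prop :=
  [/\ subvariety H, H pt1,
      forall x w, H x -> H w -> H (ptmul x w)
    & forall x, H x -> H (ptinv x)].

(* Over the algebraically closed field C, geometric irreducibility is
   irreducibility. *)
Definition subtorus H : Prop := algebraic_subgroup H /\ irreducible_set H.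

Definition torsion_point w : Prop :=
  forall i, exists2 m : nat, (0 < m)%N & m.-unity_root (w i).

Definition torsion_coset D : Prop :=
  exists w H, [/\ torsion_point w, subtorus H & D = ptmul w @` H].

Definition alg_independent_on W (r : nat) (g : 'I_r -> {mpoly C[n]}) : Prop :=
  forall P : {mpoly C[r]},
    (forall x, W x -> P.@[fun j => (g j).@[x]] = 0) -> P = 0.

(* The transcendence degree over C of the function field of an irreducible
   subvariety W; that field is the fraction field of the ring of polynomial
   functions on W, so algebraically independent families may be taken there. *)
Definition has_dim W (r : nat) : Prop :=
  (exists g : 'I_r -> {mpoly C[n]}, alg_independent_on W g) /\
  forall k (g : 'I_k -> {mpoly C[n]}), alg_independent_on W g -> (k <= r)%N.

(* Laurent polynomials are the elements p / X^m of the field of rational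
   functions. *)
Local Notation ratfun := {fraction {mpoly C[n]}}.

Definition is_laurent (h : ratfun) (p : {mpoly C[n]}) (m : 'X_{1..n}) : Prop :=
  h = tofrac p / tofrac 'X_[m].

(* Whether p vanishes at a point of the torus does not depend on the chosen
   expression p / X^m of h. *)
Definition laurent_zeros (h : ratfun) : set point :=
  [set x | Gm x /\ exists p m, is_laurent h p m /\ p.@[x] = 0].

Definition lmonomial (a : 'I_n -> int) : ratfun :=
  \prod_(i < n) tofrac 'X_i ^ a i.

Definition lconst (c : C) : ratfun := tofrac c%:MP.

(* A monomial is allowed a nonzero coefficient, so constants are the case
   a = 0 and the relation is an equivalence. *)
Definition laurent_sim (f g : ratfun) : Prop :=
  [/\ f != 0, g != 0 & exists c a, f / g = lconst c * lmonomial a].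

Definition norm2 (a : 'I_n -> int) : R :=
  Num.sqrt (\sum_(i < n) (a i)%:~R ^+ 2).

End Torus.

Arguments Gm {R n}.

(* Main.v *)
Require Import Defs.
From mathcomp Require Import all_boot all_order all_algebra.
From mathcomp Require Import boolp classical_sets reals complex mpoly.
From mathcomp Require Import zify ring lra.
Set Implicit Arguments.
Unset Strict Implicit.
Unset Printing Implicit Defensive.
Import Order.TTheory GRing.Theory Num.Theory.
Local Open Scope classical_set_scope.
Local Open Scope ring_scope.

(** (i) If the descending chain V(z,u) drops at step u, reduce a defining
    polynomial f^u by polynomials g_0, ..., g_(u-1) that witness the earlier
    drops: the remainder g_u has degree at most d z^u and a leading monomial
    divisible by none of the previous ones.  Dickson's lemma and compactness
    bound the length of such sequences, and the bound is found by an unbounded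
    search.

    (ii) The orbit of a point of S(z,V) lies on a hypersurface f = 0.  Write
    f in C[X'][Y] and take the pseudo-remainder of f(X^z) by f.  If it is
    nonzero, it vanishes on the orbit and has smaller degree in Y.  If it is
    zero, f = 0 is invariant under the power map; restrict it to a monomial
    curve X' = s^w with s > 0 small.  There the orbit of a point (s,y) tends to
    a toric boundary point, so the leading terms of f must cancel.  As z-th
    powers are expanding on the unit circle, y/|y| is an exact root of an edge
    polynomial of f, hence a root of unity of bounded order, and f divides,
    over C(X'), a power of a product of binomials X^u - X^v of bounded degree.
    Either way every point of S(z,V) satisfies a relation x^u = x^v with
    bounded u <> v; dividing u - v by its content gives the torsion coset. *)

(** For real s > 0 the terms of f along the orbit of (s,y) have moduli governed by the z^t-th powers
    of the numbers s^a |y|^j, so a single largest one would dominate for large t. The ties only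
    place y/|y| and its powers near roots of the edge polynomial; expansion of the power map then
    makes this exact. The relation found depends on the point (s,y). Hence f is compared with the
    product of all binomials of bounded degree, and curves with suitable w turn vanishing at curve
    points into divisibility up to a power of the leading coefficient in Y. Points where that
    coefficient vanishes along the orbit are left to an induction on the number of variables. In the
    bound W z^(W + nW), W bounds the degrees met during elimination, z^W the order of the root of
    unity, and z^(nW) the cost of pulling a relation at a later orbit point, at time at most nW,
    back to x. Since z^i mod m is eventually periodic, m-th roots of unity are z^k (z^l - 1)-th
    roots with k, l <= m. For V = [Gm] one has S(z,V) = [Gm], which no finite union of proper cosets
    covers; so (ii) is claimed for V <> [Gm]. *)

(** * Recursive functions and the controlled Dickson lemma *)

Section Computability.
Local Open Scope nat_scope.

Implicit Types F G B : seq nat -> nat.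

(** Functions take lists rather than tuples, so that a bounded sum or quantifier can cons its
    variable in front without casts. *)
Definition recursive (k : nat) (F : seq nat -> nat) : Prop :=
  exists f : recf k, forall v : k.-tuple nat, Defs.rgraph f v (F v).

Lemma recursive_ext k F G : (forall v : k.-tuple nat, F v = G v) -> recursive k F -> recursive k G.
Proof. by move=> FG [f hf]; exists f => v; rewrite -FG. Qed.

Lemma recursive_comp m k (G : seq nat -> nat) (F : 'I_m -> seq nat -> nat) :
  recursive m G -> (forall i, recursive k (F i)) ->
  recursive k (fun v => G [seq F i v | i <- enum 'I_m]).
Proof.
move=> [g hg] /fin_all_exists[f hf]; exists (rcomp g f) => v /=.
exists [tuple F i v | i < m]; last exact: hg.
by move=> i; rewrite tnth_mktuple.
Qed.

Lemma recursive_const k c : recursive k (fun=> c).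
Proof.
elim: c => [|c [f hf]]; first by exists (rzero k).
exists (rcomp rsucc (fun=> f)) => v /=.
by exists [tuple c] => [i|//]; rewrite (ord1 i).
Qed.

Lemma recursive_var k i : i < k -> recursive k (fun v => nth 0 v i).
Proof.
by move=> ik; exists (rproj (Ordinal ik)) => v /=; rewrite (tnth_nth 0).
Qed.

Lemma recursive_op1 (op : nat -> nat) k F :
  recursive 1 (fun v => op (nth 0 v 0)) -> recursive k F -> recursive k (fun v => op (F v)).
Proof.
move=> hop hF; have /= := recursive_comp (F := fun _ : 'I_1 => F) hop (fun=> hF).
by apply: recursive_ext => v; rewrite enum_ordSl /=.
Qed.

Lemma recursive_op2 (op : nat -> nat -> nat) k F G :
  recursive 2 (fun v => op (nth 0 v 0) (nth 0 v 1)) -> recursive k F -> recursive k G ->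
  recursive k (fun v => op (F v) (G v)).
Proof.
move=> hop hF hG.
have /= := recursive_comp (F := fun i : 'I_2 => if i == 0 :> nat then F else G) hop.
move=> /(_ k) H; have {}H := H (fun i => _); apply: recursive_ext (H _) => [v|i].
  by rewrite !enum_ordSl /=.
by case: ifP.
Qed.

Lemma recursive_reindex m k (s : seq nat) G : size s = m -> all (fun i => i < k) s ->
  recursive m G -> recursive k (fun v => G [seq nth 0 v j | j <- s]).
Proof.
move=> sm /allP sk hG.
have := @recursive_comp m k G (fun i v => nth 0 v (nth 0 s i)) hG.
move=> /(_ (fun i => recursive_var (sk _ (mem_nth 0 _)))) H.
apply: recursive_ext (H _) => [v|i]; last by rewrite sm.
congr G; apply: (@eq_from_nth _ 0); first by rewrite size_map size_enum_ord size_map sm.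
move=> i; rewrite size_map size_enum_ord => im.
rewrite (nth_map (Ordinal im)) ?size_enum_ord// (nth_map 0) ?sm//.
by rewrite (nth_enum_ord _ im).
Qed.

Lemma recursive_prec k F G (H : nat -> seq nat -> nat) B :
  recursive k F -> recursive k.+2 G -> recursive k B ->
  (forall v : k.-tuple nat, H 0 v = F v) ->
  (forall i (v : k.-tuple nat), H i.+1 v = G [:: i, H i v & v]) ->
  recursive k (fun v => H (B v) v).
Proof.
move=> [f hf] [g hg] hB H0 HS.
have hH : recursive k.+1 (fun v => H (head 0 v) (behead v)).
  exists (rprec f g) => v /=; exists (fun i => H i (behead v)).
  have HE u : thead (n := k) u = head 0 u by case/tupleP: u => x u.
  split; last by rewrite HE.
  - by rewrite (H0 [tuple of behead v]); apply: hf.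
  - move=> i _; rewrite (HS i [tuple of behead v]).
    exact: (hg [tuple of [:: i, H i (behead v) & behead v]]).
have := @recursive_comp k.+1 k _ (fun i v => nth 0 (B v :: v) i) hH.
move=> H1; apply: recursive_ext (H1 _) => [v|[[|i] /= ik]]; last 2 first.
- exact: hB.
- exact: recursive_var.
rewrite enum_ordSl /=; congr H.
rewrite -map_comp; apply: (@eq_from_nth _ 0).
  by rewrite size_map size_enum_ord size_tuple.
move=> i; rewrite size_map size_enum_ord => im.
by rewrite (nth_map (Ordinal im)) ?size_enum_ord//= (nth_enum_ord _ im).
Qed.

Lemma recursive_succ k F : recursive k F -> recursive k (fun v => (F v).+1).
Proof.
by apply: (@recursive_op1 S); exists rsucc => v /=; case/tupleP: v => x v.
Qed.

Lemma recursive_add k F G : recursive k F -> recursive k G -> recursive k (fun v => F v + G v).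
Proof.
move=> hF hG; apply: recursive_op2 hF hG.
apply: (@recursive_prec 2 (fun v => nth 0 v 1) (fun v => (nth 0 v 1).+1)
  (fun i v => i + nth 0 v 1) (fun v => nth 0 v 0)) => //; do ?exact: recursive_var.
by apply: recursive_succ; exact: recursive_var.
Qed.

Lemma recursive_mul k F G : recursive k F -> recursive k G -> recursive k (fun v => F v * G v).
Proof.
move=> hF hG; apply: recursive_op2 hF hG.
apply: (@recursive_prec 2 (fun=> 0) (fun v => nth 0 v 3 + nth 0 v 1)
  (fun i v => i * nth 0 v 1) (fun v => nth 0 v 0)) => //; do ?exact: recursive_var.
- exact: recursive_const.
- by apply: recursive_add; exact: recursive_var.
Qed.

Lemma recursive_exp k F G : recursive k F -> recursive k G -> recursive k (fun v => F v ^ G v).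
Proof.
move=> hF hG; apply: recursive_op2 hF hG.
apply: (@recursive_prec 2 (fun=> 1) (fun v => nth 0 v 2 * nth 0 v 1)
  (fun i v => nth 0 v 0 ^ i) (fun v => nth 0 v 1)) => //; do ?exact: recursive_var.
- exact: recursive_const.
- by apply: recursive_mul; exact: recursive_var.
- by move=> i v /=; rewrite expnS.
Qed.

Lemma recursive_pred k F : recursive k F -> recursive k (fun v => (F v).-1).
Proof.
apply: recursive_op1.
apply: (@recursive_prec 1 (fun=> 0) (fun v => nth 0 v 0) (fun i _ => i.-1)
  (fun v => nth 0 v 0)) => //; do ?exact: recursive_var.
exact: recursive_const.
Qed.

Lemma recursive_subn k F G : recursive k F -> recursive k G -> recursive k (fun v => F v - G v).
Proof.
move=> hF hG; apply: recursive_op2 hF hG.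
apply: (@recursive_prec 2 (fun v => nth 0 v 0) (fun v => (nth 0 v 1).-1)
  (fun i v => nth 0 v 0 - i) (fun v => nth 0 v 1)) => //; do ?exact: recursive_var.
- by apply: recursive_pred; exact: recursive_var.
- by move=> v; rewrite subn0.
- by move=> i v; rewrite subnS.
Qed.

Lemma recursive_not k (P : seq nat -> bool) : recursive k P -> recursive k (fun v => ~~ P v).
Proof.
move=> hP; apply: (@recursive_ext _ (fun v => 1 - P v)); first by move=> v; case: (P v).
exact: recursive_subn (recursive_const _ _) hP.
Qed.

Lemma recursive_ltn k F G : recursive k F -> recursive k G -> recursive k (fun v => F v < G v).
Proof.
move=> hF hG; apply: (@recursive_ext _ (fun v => 1 - (1 - (G v - F v)))).
  by move=> v; lia.
by do ![exact: recursive_const|apply: recursive_subn].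
Qed.

Lemma recursive_leq k F G : recursive k F -> recursive k G -> recursive k (fun v => F v <= G v).
Proof.
move=> hF hG; apply: (@recursive_ext _ (fun v => 1 - (F v - G v))).
  by move=> v; lia.
by do ![exact: recursive_const|apply: recursive_subn].
Qed.

Lemma recursive_and k (P Q : seq nat -> bool) :
  recursive k P -> recursive k Q -> recursive k (fun v => P v && Q v).
Proof.
move=> hP hQ; apply: (@recursive_ext _ (fun v => P v * Q v)); last exact: recursive_mul.
by move=> v; case: (P v); case: (Q v).
Qed.

Lemma recursive_sum k F B : recursive k.+1 F -> recursive k B ->
  recursive k (fun v => \sum_(i < B v) F (val i :: v)).
Proof.
move=> hF hB.
apply: (@recursive_prec k (fun=> 0)
  (fun w => nth 0 w 1 + F (nth 0 w 0 :: behead (behead w)))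
  (fun b v => \sum_(i < b) F (val i :: v)) B) => //.
- exact: recursive_const.
- apply: recursive_add; first exact: recursive_var.
  have := @recursive_reindex k.+1 k.+2 (0 :: iota 2 k) F.
  rewrite /= size_iota => /(_ erefl _ hF) H; apply: recursive_ext (H _).
    move=> v /=; congr (F (_ :: _)); apply: (@eq_from_nth _ 0).
      by rewrite size_map size_iota !size_behead size_tuple.
    move=> i; rewrite size_map size_iota => ik.
    by rewrite (nth_map 0) ?size_iota// nth_iota// !nth_behead.
  by apply/allP => i; rewrite mem_iota; lia.
- by move=> v; rewrite big_ord0.
- by move=> i v; rewrite big_ord_recr.
Qed.

Lemma recursive_all k (P : seq nat -> bool) B : recursive k.+1 P -> recursive k B ->
  recursive k (fun v => [forall i : 'I_(B v), P (val i :: v)]).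
Proof.
move=> hP hB.
have /recursive_not h := recursive_ltn (recursive_const k 0) (recursive_sum (recursive_not hP) hB).
apply: recursive_ext h => v; rewrite -eqn0Ngt sum_nat_eq0.
by congr (nat_of_bool _); apply: eq_forallb => i; rewrite eqb0 negbK.
Qed.

Lemma recursive_ex k (P : seq nat -> bool) B : recursive k.+1 P -> recursive k B ->
  recursive k (fun v => [exists i : 'I_(B v), P (val i :: v)]).
Proof.
move=> hP hB; apply: recursive_ext (recursive_not (recursive_all (recursive_not hP) hB)) => v.
by rewrite negb_forall; congr (nat_of_bool _); apply: eq_existsb => i; rewrite negbK.
Qed.

Lemma recursive_divn k F G : recursive k F -> recursive k G -> (forall v : k.-tuple nat, 0 < G v) ->
  recursive k (fun v => F v %/ G v).
Proof.
move=> hF hG G0.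
(* For d > 0 the quotient m %/ d counts the i < m with (i + 1) d <= m. *)
have hdiv : recursive 2 (fun v => \sum_(i < nth 0 v 0) (i.+1 * nth 0 v 1 <= nth 0 v 0)).
  apply: (@recursive_sum 2 (fun v => ((nth 0 v 0).+1 * nth 0 v 2 <= nth 0 v 1))).
    apply: recursive_leq; last exact: recursive_var.
    by apply: recursive_mul; [apply: recursive_succ|]; exact: recursive_var.
  exact: recursive_var.
have := recursive_op2 (op := fun m d => \sum_(i < m) (i.+1 * d <= m)) hdiv hF hG.
apply: recursive_ext => v; move: (G v) (F v) (G0 v) => d m d0.
under eq_bigr => i _ do rewrite -leq_divRL//.
have le : m %/ d <= m by exact: leq_div.
rewrite (eq_bigr (fun i : 'I_m => if (i < m %/ d) then 1 else 0)); last first.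
  by move=> i _; case: ifP.
by rewrite -big_mkcond/= (big_ord_narrow le) sum1_card card_ord.
Qed.

Lemma recursive_modn k F G : recursive k F -> recursive k G -> (forall v : k.-tuple nat, 0 < G v) ->
  recursive k (fun v => F v %% G v).
Proof.
move=> hF hG G0; apply: (@recursive_ext _ (fun v => F v - F v %/ G v * G v)).
  by move=> v; rewrite {1}(divn_eq (F v) (G v)) addKn.
by apply: recursive_subn => //; apply: recursive_mul => //; apply: recursive_divn.
Qed.

Lemma recursive_mu k (P : seq nat -> bool) (M : seq nat -> nat) :
  recursive k.+1 P ->
  (forall v : k.-tuple nat, P (M v :: v) /\ forall i, i < M v -> ~~ P (i :: v)) ->
  recursive k M.
Proof.
(* [rmu] looks for a zero, so the search runs on the negation of [P]. *)
move=> /recursive_not[f hf] hM; exists (rmu f) => v /=; have [PM Pi] := hM v; split.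
  by have := hf [tuple of M v :: v]; rewrite /= PM.
by move=> i /Pi nP; exists 0; have := hf [tuple of i :: v]; rewrite /= nP.
Qed.

Lemma recursive_iter k (h : nat -> seq nat -> nat) F B :
  recursive k.+1 (fun v => h (head 0 v) (behead v)) -> recursive k F -> recursive k B ->
  recursive k (fun v => iter (B v) (h^~ v) (F v)).
Proof.
move=> hh hF hB.
apply: (@recursive_prec k F (fun v => h (nth 0 v 1) (behead (behead v)))
  (fun b v => iter b (h^~ v) (F v)) B) => //.
have := @recursive_reindex k.+1 k.+2 (iota 1 k.+1) _ _ _ hh.
rewrite size_iota => /(_ erefl) H; apply: recursive_ext (H _) => [v|].
  case/tupleP: v => a v; case/tupleP: v => b v /=; congr h.
  apply: (@eq_from_nth _ 0); first by rewrite size_map size_iota size_tuple.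
  move=> i; rewrite size_map size_iota => ik.
  by rewrite (nth_map 0) ?size_iota// nth_iota.
by apply/allP => i; rewrite mem_iota; lia.
Qed.
End Computability.

Section Dickson.
Local Open Scope nat_scope.

Lemma monotone_subsequence (f : nat -> nat) : exists h : nat -> nat,
  {homo h : a b / a < b} /\ {homo f \o h : a b / a <= b}.
Proof.
(* Take an index where f is least among all indices from k on; restarting after it again and again
   gives the subsequence. *)
have tail k : exists j, k <= j /\ forall j', j <= j' -> f j <= f j'.
  have ex : exists c, `[< exists2 j, k <= j & f j = c >].
    by exists (f k); apply/asboolP; exists k.
  have [c /asboolP[j kj <-] cmin] := ex_minnP ex.
  exists j; split=> // j' jj'; apply: cmin; apply/asboolP.
  by exists j' => //; apply: leq_trans jj'.
have [N hN] := choice tail.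
pose h := fix h k := if k is k'.+1 then N (h k').+1 else N 0.
have hS k : h k < h k.+1 by have [] := hN (h k).+1.
have hmono : {homo h : a b / a < b} by exact: homo_ltn ltn_trans hS.
exists h; split => // a b; rewrite leq_eqVlt => /orP[/eqP->//|/hmono ab] /=.
have hmin k j' : h k <= j' -> f (h k) <= f j'.
  by case: k => [|k] /=; [have [_] := hN 0|have [_] := hN (h k).+1]; apply.
exact/hmin/ltnW.
Qed.

Lemma dickson (n : nat) (m : nat -> nat -> nat) :
  exists h : nat -> nat, {homo h : a b / a < b} /\
    forall i, i < n -> {homo (fun t => m (h t) i) : a b / a <= b}.
Proof.
elim: n => [|n [h [hh hm]]]; first by exists id; split.
have [h' [hh' hm']] := monotone_subsequence (fun t => m (h t) n).
exists (h \o h'); split=> [a b ab|i]; first by apply/hh/hh'.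
rewrite ltnS leq_eqVlt => /orP[/eqP->//|/hm hi] a b ab /=.
apply: hi; move: ab; rewrite leq_eqVlt => /orP[/eqP->//|/hh'/ltnW//].
Qed.

(** Fix the values of q one index at a time, always keeping infinitely many [u]; the bound [b k]
    leaves only finitely many choices, so some choice keeps infinitely many. *)
Lemma konig (p : nat -> nat -> nat) (b : nat -> nat) :
  (forall u k, k <= u -> p u k <= b k) ->
  exists q : nat -> nat, forall K U, exists2 u, U <= u &
    forall k, k < K -> p u k = q k.
Proof.
move=> pb; pose Inf (A : nat -> Prop) := forall U, exists2 u, U <= u & A u.
(* The premise stands under the existential so that [choice] gives a function on all pairs. *)
have step (Ak : (nat -> Prop) * nat) : exists c, Inf Ak.1 ->
    Inf (fun u => Ak.1 u /\ p u Ak.2 = c).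
  case: Ak => A k /=; apply: contrapT => /forallNP noc.
  have {}noc c : Inf A /\ exists U, forall u, U <= u -> A u -> p u k <> c.
    have /not_implyP[IA /existsNP[U hU]] := noc c; split=> //; exists U => u Uu Au pc.
    by apply: hU; exists u.
  have [V hV] := choice (fun c => (noc c).2).
  have [u Uu Au] := (noc 0).1 (maxn k (\max_(c < (b k).+1) V c)).
  move: Uu; rewrite geq_max => /andP[/pb pu Vu].
  have pu' : p u k < (b k).+1 by [].
  apply: (hV (p u k) u) => //; apply: leq_trans Vu.
  exact: (leq_bigmax (Ordinal pu')).
have [nxt hnxt] := choice step.
pose A := fix A k := if k is k'.+1 then
   (fun u => A k' u /\ p u k' = nxt (A k', k')) else fun=> True.
have AInf k : Inf (A k).
  elim: k => [U|k /(hnxt (A k, k))//]; by exists U.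
exists (fun k => nxt (A k, k)) => K U.
have [u Uu Au] := AInf K U; exists u => // k.
elim: K Au => // K IH [/IH{}IH pK]; rewrite ltnS leq_eqVlt => /orP[/eqP->//|].
exact: IH.
Qed.

(** Bad sequences of every length, flattened by putting entry i of vector t at index t * n + i,
    would have a limit by [konig]. [dickson] finds a good pair in the limit, and a long bad sequence
    agreeing with the limit that far contains it too. *)
Lemma controlled_dickson (n : nat) (g : nat -> nat) : exists u,
  forall m : nat -> nat -> nat,
  (forall t i, t <= u -> i < n -> m t i <= g t) ->
  exists t1 t2, [/\ t1 < t2, t2 <= u & forall i, i < n -> m t1 i <= m t2 i].
Proof.
have [->|n0] := posnP n; first by exists 1 => m _; exists 0, 1.
apply: contrapT => /forallNP bad.
have {}bad u : exists m : nat -> nat -> nat,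
  (forall t i, t <= u -> i < n -> m t i <= g t) /\
  forall t1 t2, t1 < t2 -> t2 <= u -> ~ forall i, i < n -> m t1 i <= m t2 i.
  have /existsNP[m /not_implyP[hm nm]] := bad u; exists m; split=> // t1 t2 h1 h2 h3.
  by apply: nm; exists t1, t2.
have [m hm] := choice bad.
have [|q hq] := @konig (fun u k => m u (k %/ n) (k %% n)) (fun k => g (k %/ n)).
  move=> u k ku; apply: (hm u).1; last exact: ltn_pmod.
  exact: leq_trans (leq_div _ _) ku.
have [h [hh hd]] := dickson n (fun t i => q (t * n + i)).
have [u Uu hu] := hq ((h 1).+1 * n) (h 1).
have h01 : h 0 < h 1 by exact: hh.
apply: ((hm u).2 _ _ h01 Uu) => i ni.
have val t : t <= h 1 -> m u t i = q (t * n + i).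
  move=> th; rewrite -hu ?divnMDl// ?divn_small// ?addn0 ?modnMDl ?modn_small//.
  by apply: (@leq_trans (t * n + n)); rewrite ?ltn_add2l// -mulSnr leq_mul2r ltnS th orbT.
by rewrite !val ?(ltnW h01)//; exact: (hd i ni 0 1).
Qed.

(** Finite sequences are coded as numbers in base [b]; the absence of bad sequences of a given
    length then becomes a bounded quantifier over codes, hence a recursive predicate. *)
Definition digit (b c k : nat) := c %/ b ^ k %% b.

Lemma digits_exist b K (p : nat -> nat) : (forall k, k < K -> p k < b) ->
  exists2 c, c < b ^ K & forall k, k < K -> digit b c k = p k.
Proof.
elim: K => [|K IH] pb; first by exists 0.
have [k kK|c cb hc] := IH; first by apply: pb; apply: leqW.
have b0 : 0 < b by apply: leq_ltn_trans (pb 0 _).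
exists (p K * b ^ K + c).
  rewrite expnS -ltn_divLR ?expn_gt0 ?b0// divnMDl ?expn_gt0 ?b0//.
  by rewrite divn_small// addn0 pb.
move=> k; rewrite ltnS leq_eqVlt /digit => /orP[/eqP->|kK].
  by rewrite divnMDl ?expn_gt0 ?b0// divn_small// addn0 modn_small// pb.
have -> : b ^ K = b ^ (K - k.+1) * b * b ^ k by rewrite -expnSr -expnD; congr expn; lia.
by rewrite mulnA divnMDl ?expn_gt0 ?b0// mulnA modnMDl -/(digit b c k) hc.
Qed.

Definition bad_code (z n d u c : nat) :=
  let b := (d * z ^ u).+1 in
  [forall t : 'I_u.+1, forall i : 'I_n, digit b c (t * n + i) <= d * z ^ t] &&
  [forall t2 : 'I_u.+1, forall t1 : 'I_t2, exists i : 'I_n,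
     digit b c (t2 * n + i) < digit b c (t1 * n + i)].

Definition no_bad_code (z n d u : nat) :=
  ~~ [exists c : 'I_((d * z ^ u).+1 ^ (u.+1 * n)), bad_code z n d u c].

Lemma no_bad_code_ex z n d : exists u, no_bad_code z n d u.
Proof.
have [u hu] := controlled_dickson n (fun t => d * z ^ t); exists u.
apply/existsP => -[c /andP[/forallP h1 /forallP h2]].
pose m t i := digit (d * z ^ u).+1 c (t * n + i).
have [|t1 [t2 [t12 t2u hm]]] := hu m.
  move=> t i tu ni; have tu' : t < u.+1 by [].
  exact: (forallP (h1 (Ordinal tu')) (Ordinal ni)).
have t2u' : t2 < u.+1 by [].
have : [exists i : 'I_n, digit (d * z ^ u).+1 c (t2 * n + i) <
    digit (d * z ^ u).+1 c (t1 * n + i)].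
  exact: (forallP (h2 (Ordinal t2u')) (Ordinal t12)).
case/existsP => i.
by rewrite ltnNge => /negP; apply; apply: hm.
Qed.

Definition stab_time z n d := ex_minn (no_bad_code_ex z n d).

Lemma stab_time_good z n d (m : nat -> nat -> nat) : 0 < z ->
  (forall t i, t <= stab_time z n d -> i < n -> m t i <= d * z ^ t) ->
  exists t1 t2, [/\ t1 < t2, t2 <= stab_time z n d &
    forall i, i < n -> m t1 i <= m t2 i].
Proof.
move=> z0; rewrite /stab_time; case: ex_minnP => u hu _ mc.
apply: contrapT => nog; apply/negP: hu; rewrite negbK.
set b := (d * z ^ u).+1.
have mb t i : t <= u -> i < n -> m t i < b.
  move=> tu ni; rewrite ltnS; apply: leq_trans (mc t i tu ni) _.
  by rewrite leq_mul2l leq_pexp2l ?orbT.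
have [|c cb hc] := @digits_exist b (u.+1 * n) (fun k => m (k %/ n) (k %% n)).
  move=> k kn; have n0 : 0 < n by case: (n) kn; rewrite ?muln0.
  by apply: mb; rewrite ?ltn_pmod// -ltnS ltn_divLR.
have val t i : t <= u -> i < n -> digit b c (t * n + i) = m t i.
  move=> tu ni; have n0 := leq_ltn_trans (leq0n i) ni.
  rewrite hc ?divnMDl// ?divn_small// ?addn0 ?modnMDl ?modn_small//.
  by apply: (@leq_trans (t * n + n)); rewrite ?ltn_add2l// -mulSnr leq_mul2r ltnS tu orbT.
apply/existsP; exists (Ordinal cb); apply/andP; split.
  by apply/forallP => t; apply/forallP => i; rewrite val ?mc// -ltnS.
apply/forallP => t2; apply/forallP => t1; apply: contrapT => /negP/existsPn nex.
have t2u : t2 <= u by rewrite -ltnS.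
apply: nog; exists t1, t2; split=> // i ni.
have := nex (Ordinal ni); rewrite -leqNgt !val//.
exact: leq_trans (ltnW (ltn_ord t1)) t2u.
Qed.

Lemma stab_time_computable : computable3 stab_time.
Proof.
(* The list is u, z, n, d. Each bounded quantifier below puts its variable at the head: first the
   code c, then t or t2, then i or t1, which shifts the positions by one each time. *)
pose P (v : seq nat) := no_bad_code (nth 0 v 1) (nth 0 v 2) (nth 0 v 3) (nth 0 v 0).
suff hP : recursive 4 P.
  have [|f hf] := @recursive_mu 3 P
    (fun v => stab_time (nth 0 v 0) (nth 0 v 1) (nth 0 v 2)) hP.
    move=> v; rewrite /P /= /stab_time; case: ex_minnP => u hu umin; split=> // i iu.
    by apply/negP => /umin; rewrite leqNgt iu.
  by exists f => a b c; apply: (hf [tuple a; b; c]).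
have var := recursive_var.
have hdig k (f g h : seq nat -> nat) : recursive k f -> recursive k g -> recursive k h ->
    recursive k (fun v => digit (f v).+1 (g v) (h v)).
  move=> hf hg hh; apply: recursive_modn => //; last exact: recursive_succ.
  by apply: recursive_divn => [||v]; rewrite ?expn_gt0//;
    apply: recursive_exp => //; apply: recursive_succ.
have hctl k a b c : a < k -> b < k -> c < k ->
    recursive k (fun v => nth 0 v a * nth 0 v b ^ nth 0 v c).
  by move=> *; apply: recursive_mul; [|apply: recursive_exp]; apply: var.
have hidx k a b c : a < k -> b < k -> c < k ->
    recursive k (fun v => nth 0 v a * nth 0 v b + nth 0 v c).
  by move=> *; apply: recursive_add; [apply: recursive_mul|]; apply: var.
apply: recursive_not.
pose Q (v : seq nat) :=
  bad_code (nth 0 v 2) (nth 0 v 3) (nth 0 v 4) (nth 0 v 1) (nth 0 v 0).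
apply: (@recursive_ex 4 Q (fun v => (nth 0 v 3 * nth 0 v 1 ^ nth 0 v 0).+1 ^
                              ((nth 0 v 0).+1 * nth 0 v 2))); last first.
  apply: recursive_exp; first by apply: recursive_succ; apply: hctl.
  by apply: recursive_mul; [apply: recursive_succ|]; apply: var.
apply: recursive_and.
- apply: (@recursive_all 5 (fun v => [forall i : 'I_(nth 0 v 4),
     digit (nth 0 v 5 * nth 0 v 3 ^ nth 0 v 2).+1 (nth 0 v 1)
       (nth 0 v 0 * nth 0 v 4 + i) <= nth 0 v 5 * nth 0 v 3 ^ nth 0 v 0])
     (fun v => (nth 0 v 1).+1)); last by apply: recursive_succ; apply: var.
  apply: (@recursive_all 6 (fun v =>
     digit (nth 0 v 6 * nth 0 v 4 ^ nth 0 v 3).+1 (nth 0 v 2)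
       (nth 0 v 1 * nth 0 v 5 + nth 0 v 0) <= nth 0 v 6 * nth 0 v 4 ^ nth 0 v 1)
     (fun v => nth 0 v 4)); last exact: var.
  by apply: recursive_leq; [apply: hdig; [apply: hctl|apply: var|apply: hidx]|apply: hctl].
- apply: (@recursive_all 5 (fun v => [forall t1 : 'I_(nth 0 v 0), exists i : 'I_(nth 0 v 4),
     digit (nth 0 v 5 * nth 0 v 3 ^ nth 0 v 2).+1 (nth 0 v 1) (nth 0 v 0 * nth 0 v 4 + i) <
     digit (nth 0 v 5 * nth 0 v 3 ^ nth 0 v 2).+1 (nth 0 v 1) (t1 * nth 0 v 4 + i)])
     (fun v => (nth 0 v 1).+1)); last by apply: recursive_succ; apply: var.
  apply: (@recursive_all 6 (fun v => [exists i : 'I_(nth 0 v 5),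
     digit (nth 0 v 6 * nth 0 v 4 ^ nth 0 v 3).+1 (nth 0 v 2) (nth 0 v 1 * nth 0 v 5 + i) <
     digit (nth 0 v 6 * nth 0 v 4 ^ nth 0 v 3).+1 (nth 0 v 2) (nth 0 v 0 * nth 0 v 5 + i)])
     (fun v => nth 0 v 0)); last exact: var.
  apply: (@recursive_ex 7 (fun v =>
     digit (nth 0 v 7 * nth 0 v 5 ^ nth 0 v 4).+1 (nth 0 v 3) (nth 0 v 2 * nth 0 v 6 + nth 0 v 0) <
     digit (nth 0 v 7 * nth 0 v 5 ^ nth 0 v 4).+1 (nth 0 v 3) (nth 0 v 1 * nth 0 v 6 + nth 0 v 0))
     (fun v => nth 0 v 5)); last exact: var.
  by apply: recursive_ltn; apply: hdig; [apply: hctl|apply: var|apply: hidx|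
    apply: hctl|apply: var|apply: hidx].
Qed.
End Dickson.

(** * Stabilization of V(z,u) *)

Section Reduction.
Variables (K : fieldType) (n : nat).
Implicit Types (p q r : {mpoly K[n]}) (g : nat -> {mpoly K[n]}).

Lemma mlead_cancel p q : p - q != 0 -> mlead p = mlead q ->
  mleadc p = mleadc q -> (mlead (p - q) < mlead p)%O.
Proof.
move=> pq0 epq cpq; rewrite lt_neqAle; apply/andP; split.
  apply: contra_neq pq0 => e; apply/eqP.
  by rewrite -mleadc_eq0 e mcoeffB cpq epq subrr.
by have := mleadB_le p q; rewrite -epq joinxx.
Qed.

(* Division by a finite family along a degree-compatible monomial order never
   raises the degree, so no Groebner basis is needed. *)
Lemma mreduce g (u : nat) p : (forall i, (i < u)%N -> g i != 0) ->
  exists r, [/\ (msize r <= msize p)%N,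
    forall x, (forall i, (i < u)%N -> (g i).@[x] = 0) -> r.@[x] = p.@[x]
    & r = 0 \/ forall i, (i < u)%N -> ~~ (mlead (g i) <= mlead r)%MM].
Proof.
move=> g0; elim/mleadrect: p => p IH.
have [->|p0] := eqVneq p 0; first by exists 0; split=> //; left.
have [[i iu di]|nd] := pselect (exists2 i, (i < u)%N & (mlead (g i) <= mlead p)%MM);
  last first.
  by exists p; split=> //; right=> i iu; apply/negP => di; apply: nd; exists i.
set c := mleadc p / mleadc (g i).
set q := c *: ('X_[mlead p - mlead (g i)] * g i).
have gi0 := g0 _ iu.
have lg0 : mleadc (g i) != 0 by rewrite mleadc_eq0.
have lp0 : mleadc p != 0 by rewrite mleadc_eq0.
have c0 : c != 0 by rewrite mulf_neq0 ?invr_eq0.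
have X0 : ('X_[mlead p - mlead (g i)] : {mpoly K[n]}) != 0.
  by rewrite -mleadc_eq0 mleadXm mcoeffX eqxx oner_eq0.
have lq' : mlead ('X_[mlead p - mlead (g i)] * g i) = mlead p.
  by rewrite mleadM// mleadXm submK.
have cq' : mleadc ('X_[mlead p - mlead (g i)] * g i) = mleadc (g i).
  by rewrite mleadM// mleadcM mleadXm mcoeffX eqxx mul1r.
have lq : mlead q = mlead p.
  by rewrite /q mleadZ_proper //; rewrite cq' mulf_neq0.
have cq : mleadc q = mleadc p.
  rewrite lq /q mcoeffZ; set h := _ * g i.
  have -> : h@_(mlead p) = mleadc (g i) by rewrite -cq' lq'.
  by rewrite /c mulfVK.
have evq x : (forall i, (i < u)%N -> (g i).@[x] = 0) -> (p - q).@[x] = p.@[x].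
  by move=> hx; rewrite mevalB mevalZ mevalM hx// mulr0 mulr0 subr0.
have [e|pq0] := eqVneq (p - q) 0.
  exists 0; split=> [|x /evq|]; rewrite ?msize0// ?e ?meval0//; by left.
have lt : (mlead (p - q) < mlead p)%O by apply: mlead_cancel.
have [r [sr er hr]] := IH _ lt; exists r; split=> // [|x hx]; last by rewrite er ?evq.
apply: leq_trans sr _; rewrite -!mlead_deg// ltnS; exact: lemc_mdeg (ltW lt).
Qed.

Lemma msize_comp_pow k p :
  (msize (p \mPo [tuple 'X_i ^+ k | i < n]) <= ((msize p).-1 * k).+1)%N.
Proof.
rewrite comp_mpolyEX; apply: leq_trans (msize_sum _ _ _) _.
apply/bigmax_leqP_seq => m mp _; apply: leq_trans (msizeZ_le _ _) _.
rewrite comp_mpolyX (eq_bigr (fun i => 'X_i ^+ (k * m i))); last first.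
  by move=> i _; rewrite tnth_mktuple exprM.
have -> : \prod_(i < n) 'X_i ^+ (k * m i) = 'X_[m *+ k] :> {mpoly K[n]}.
  by rewrite [RHS]mpolyXE_id; apply: eq_bigr => i _; rewrite mulmnE mulnC.
rewrite msizeX ltnS mdegMn leq_mul2r; apply/orP; right.
by have := msize_mdeg_lt mp; case: (msize p).
Qed.
End Reduction.

Section Stability.
Variables (R : realType) (n z d s : nat) (f : 'I_s -> {mpoly R[i][n]}).
Hypothesis z0 : (0 < z)%N.
Hypothesis fd : forall j, (msize (f j) <= d.+1)%N.
Local Notation C := R[i].
Local Notation V := (Zset (range f)).
Local Notation T := (stab_time z n d).
Local Notation phi := (@power_map R n z).

Lemma iter_power_map t (x : 'I_n -> C) : iter t phi x = power_map (z ^ t) x.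
Proof.
elim: t => [|t IH]; apply/funext => i; rewrite /power_map /= ?expr1//.
by rewrite /power_map IH -exprM expnSr.
Qed.

Lemma Gm_power_map k (x : 'I_n -> C) : Gm x -> Gm (power_map k x).
Proof. by move=> x0 i; rewrite expf_neq0. Qed.

Lemma Gm_iter t (x : 'I_n -> C) : Gm x -> Gm (iter t phi x).
Proof. by rewrite iter_power_map; apply: Gm_power_map. Qed.

Definition fpow j t : {mpoly C[n]} := f j \mPo [tuple 'X_i ^+ (z ^ t) | i < n].

Lemma fpow_eval j t x : (fpow j t).@[x] = (f j).@[iter t phi x].
Proof.
rewrite comp_mpoly_meval iter_power_map; apply: meval_eq => i.
by rewrite tnth_mktuple rmorphXn/= mevalXU.
Qed.

Lemma msize_fpow j t : (msize (fpow j t) <= (d * z ^ t).+1)%N.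
Proof.
apply: leq_trans (msize_comp_pow _ _) _; rewrite ltnS leq_mul2r; apply/orP; right.
by have := fd j; case: (msize (f j)).
Qed.

(** The strict bound makes the chain start at the whole torus, so a drop can already occur at step
    0. *)
Definition Vlt (u : nat) : set ('I_n -> C) :=
  [set x | Gm x /\ forall t j, (t < u)%N -> (f j).@[iter t phi x] = 0].

Lemma Vzu_Vlt u : Vzu V z u = Vlt u.+1.
Proof.
apply/seteqP; split=> x [x0 hx]; split=> // t.
  by move=> j tu; have [_] := hx t tu; apply; exists j.
by move=> tu; split=> [|_ [j _ <-]]; [exact: Gm_iter|exact: hx].
Qed.

Lemma Vlt_le u v : (u <= v)%N -> Vlt v `<=` Vlt u.
Proof. by move=> uv x [x0 hx]; split=> // t j tu; apply: hx; apply: leq_trans uv. Qed.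

(** One pause of the chain means that the power map sends [Vlt u] into itself, so the chain pauses
    for ever. *)
Lemma Vlt_stabilize u : Vlt u `<=` Vlt u.+1 -> forall k, Vlt u `<=` Vlt (u + k).
Proof.
move=> uS; elim=> [|k IH] x ux; first by rewrite addn0.
have [x0 hx] := uS _ ux.
have /IH[_ hk] : Vlt u (phi x).
  split=> [|t j tu]; first exact: Gm_power_map.
  by rewrite -iterSr hx.
split=> // -[|t] j; first by move=> _; apply: hx.
by rewrite addnS ltnS => /hk; rewrite -iterSr.
Qed.

Lemma Vlt_stab_time u : Vlt T.+1 `<=` Vlt u.
Proof.
apply: contrapT => nsub.
have strict v : (v <= T)%N ->
    exists y, Vlt v y /\ exists j, (fpow j v).@[y] != 0.
  move=> vT; apply: contrapT => /forallNP noy; apply: nsub.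
  apply: (@subset_trans _ (Vlt v)); first by apply: Vlt_le; apply: leqW.
  apply: (@subset_trans _ (Vlt (v + u))); last by apply: Vlt_le; apply: leq_addl.
  apply: Vlt_stabilize => y vy; have [y0 hy] := vy; split=> // t j.
  rewrite ltnS leq_eqVlt => /orP[/eqP->|]; last exact: hy.
  have /not_andP[//|/forallNP/(_ j)/negP] := noy y.
  by rewrite negbK fpow_eval => /eqP.
have [g hg] : exists g : nat -> {mpoly C[n]}, forall v, (v < T.+1)%N ->
    [/\ forall x, Vlt v.+1 x -> (g v).@[x] = 0, g v != 0,
        (msize (g v) <= (d * z ^ v).+1)%N &
        forall i, (i < v)%N -> ~~ (mlead (g i) <= mlead (g v))%MM].
  have : (T.+1 <= T.+1)%N by []; elim: {1 3}T.+1 => [|k IH] kT.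
    by exists (fun=> 0).
  have [g hg] := IH (ltnW kT).
  have [y [yk [j fy]]] := strict k kT.
  have [|r [sr er hr]] := @mreduce _ _ g k (fpow j k).
    by move=> i ik; have [] := hg i ik.
  (* All earlier g_i vanish at the witness y of the drop, so reduction keeps the value there and the
     remainder cannot be 0. *)
  have ery : r.@[y] = (fpow j k).@[y].
    apply: er => i ik; have [gi _ _ _] := hg i ik; apply: gi; exact: Vlt_le yk.
  have r0 : r != 0 by apply: contraNneq fy => r0; rewrite -ery r0 meval0.
  exists (fun v => if v == k then r else g v) => v.
  rewrite ltnS leq_eqVlt => /orP[/eqP->|vk].
    rewrite eqxx; split=> // [x xk||].
    - have [_ hx] := xk.
      rewrite er ?fpow_eval ?hx// => i ik.
      by have [gi _ _ _] := hg i ik; apply: gi; apply: Vlt_le xk; apply: leqW.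
    - exact: leq_trans sr (msize_fpow _ _).
    - move=> i ik; rewrite ltn_eqF//; case: hr => [e|]; last exact.
      by rewrite e eqxx in r0.
  have [g1 g2 g3 g4] := hg v vk; rewrite ltn_eqF//; split=> // i iv.
  by rewrite ltn_eqF ?g4// (ltn_trans iv).
have [|t1 [t2 [t12 t2T hm]]] :=
  @stab_time_good z n d (fun t i => nth 0%N (mlead (g t)) i) z0.
  move=> t i tT ni; have [_ g0 sg _] := hg t tT.
  have : (mdeg (mlead (g t)) <= d * z ^ t)%N by rewrite -ltnS mlead_deg.
  by apply: leq_trans; rewrite mdegE (bigD1 (Ordinal ni))//= (mnm_nth 0%N) leq_addr .
have [_ _ _ /(_ t1 t12)/negP] := hg t2 t2T; apply.
by apply/mnm_lepP => i; rewrite !(mnm_nth 0%N) hm.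
Qed.

Lemma Vzu_subvariety u : subvariety (Vzu V z u).
Proof.
exists [set p | exists t j, (t <= u)%N /\ p = fpow j t].
rewrite Vzu_Vlt; apply/seteqP; split=> x [x0 hx]; split=> //.
  by move=> _ [t [j [tu ->]]]; rewrite fpow_eval hx.
by move=> t j tu; rewrite -fpow_eval; apply: hx; exists t, j.
Qed.

Lemma Vzu_stab_time_sub u : Vzu V z T `<=` Vzu V z u.
Proof. rewrite !Vzu_Vlt; exact: Vlt_stab_time. Qed.

Lemma stable_Vzu_stab_time : stable z V (Vzu V z T).
Proof.
split=> [|x|u _]; first exact: Vzu_subvariety; last exact: Vzu_stab_time_sub.
by case=> _ /(_ 0%N); apply.
Qed.

Lemma stable_sub_Vzu S : stable z V S -> S `<=` Vzu V z T.
Proof.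
(* Stability speaks of positive u only and T may be 0, hence the detour through [T.+1]. *)
case=> _ _ /(_ T.+1 isT) h x /h.
by rewrite !Vzu_Vlt; apply: Vlt_le.
Qed.

Lemma unique_maximal_stable : unique (maximal_stable z V) (Vzu V z T).
Proof.
split; first split.
- exact: stable_Vzu_stab_time.
- by case=> S' [/stable_sub_Vzu S'T [TS' nS'T]].
- move=> S [stS noS]; apply/seteqP; split; last exact: stable_sub_Vzu.
  apply: contrapT => nsub; apply: noS; exists (Vzu V z T); split.
    exact: stable_Vzu_stab_time.
  by split=> //; apply: stable_sub_Vzu.
Qed.
End Stability.

(** * Dynamics of the power map near the unit circle *)

Section Reals.
Variable R : realType.
Implicit Types (x q e : R).

Lemma expr_unbounded x M : 1 < x -> exists t, M < x ^+ t.
Proof.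
move=> x1; have bern t : 1 + (x - 1) *+ t <= x ^+ t.
  elim: t => [|t IH]; first by rewrite expr0 mulr0n addr0.
  rewrite exprS; apply: (@le_trans _ _ (x * (1 + (x - 1) *+ t))); last first.
    by rewrite ler_pM2l//; lra.
  have : 0 <= (x - 1) * ((x - 1) *+ t) by rewrite mulr_ge0 ?mulrn_wge0//; lra.
  rewrite mulrS; set y := _ *+ t; nra.
have x0 : 0 < x - 1 by lra.
have := archi_boundP (normr_ge0 (M / (x - 1))); set t := Num.bound _ => ht.
exists t; apply: lt_le_trans (bern t); rewrite -mulr_natl.
have : M < t%:R * (x - 1).
  rewrite -ltr_pdivrMr//; exact: le_lt_trans (ler_norm _) ht.
lra.
Qed.

Lemma expr_small q e : 0 <= q < 1 -> 0 < e -> exists t, q ^+ t < e.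
Proof.
move=> /andP[]; rewrite le_eqVlt => /orP[/eqP<- _|q0 q1] e0.
  by exists 1%N; rewrite expr1.
have [|t] := @expr_unbounded q^-1 e^-1; first by rewrite invf_gt1.
by rewrite exprVn ltf_pV2 ?posrE ?exprn_gt0// => ?; exists t.
Qed.

Lemma finite_lower_bound (I : finType) (P : pred I) (e : I -> R) :
  (forall i, P i -> 0 < e i) -> exists2 b, 0 < b & forall i, P i -> b <= e i.
Proof.
move=> e0; exists (\big[Num.min/1]_(i | P i) e i).
  by elim/big_ind: _ => // x y; rewrite lt_min => -> ->.
by move=> i Pi; rewrite (bigD1 i)//= ge_min lexx.
Qed.

Lemma finite_upper_bound (I : finType) (e : I -> R) :
  exists2 b, 0 < b & forall i, e i <= b.
Proof.
exists (1 + \sum_i `|e i|); first by rewrite ltr_pwDl// sumr_ge0.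
move=> i; rewrite (bigD1 i)//= addrCA; apply: le_trans (ler_norm _) _.
by rewrite lerDl addr_ge0// sumr_ge0.
Qed.
End Reals.

Section ComplexNorm.
Variable R : realType.
Local Notation C := R[i].
Implicit Types (x y : C) (p : {poly C}).
Local Notation nc := (@ComplexField.Normc.normc R).

Lemma nc_ge0 x : 0 <= nc x.
Proof. by case: x => a b; rewrite /= sqrtr_ge0. Qed.
Lemma nc_eq0 x : (nc x == 0) = (x == 0).
Proof.
apply/eqP/eqP => [/ComplexField.Normc.eq0_normc//|->].
exact: ComplexField.Normc.normc0.
Qed.
Lemma nc_gt0 x : (0 < nc x) = (x != 0).
Proof. by rewrite lt_def nc_eq0 nc_ge0 andbT. Qed.
Lemma nc0 : nc 0 = 0. Proof. exact: ComplexField.Normc.normc0. Qed.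
Lemma nc1 : nc 1 = 1. Proof. exact: ComplexField.Normc.normc1. Qed.
Lemma ncM x y : nc (x * y) = nc x * nc y.
Proof. exact: ComplexField.Normc.normcM. Qed.
Lemma ncV x : nc x^-1 = (nc x)^-1.
Proof. exact: ComplexField.Normc.normcV. Qed.
Lemma ncX x k : nc (x ^+ k) = nc x ^+ k.
Proof. by elim: k => [|k IH]; rewrite ?expr0 ?nc1// !exprS ncM IH. Qed.
Lemma ncN x : nc (- x) = nc x.
Proof. by case: x => a b /=; rewrite !sqrrN. Qed.
Lemma ncD x y : nc (x + y) <= nc x + nc y.
Proof.
have /(_ x y) := @ler_normD _ C; rewrite !normc_def -!rmorphD/= lecR.
by case: x; case: y.
Qed.
Lemma ncB x y : nc (x - y) <= nc x + nc y.
Proof. by rewrite -(ncN y); apply: ncD. Qed.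
Lemma nc_distC x y : nc (x - y) = nc (y - x).
Proof. by rewrite -ncN opprB. Qed.
Lemma ncR (a : R) : 0 <= a -> nc a%:C%C = a.
Proof. by move=> a0 /=; rewrite expr0n addr0 sqrtr_sqr ger0_norm. Qed.
Lemma nc_sum (I : Type) (r : seq I) (P : pred I) (F : I -> C) :
  nc (\sum_(i <- r | P i) F i) <= \sum_(i <- r | P i) nc (F i).
Proof.
elim/big_ind2: _ => [|x a y b xa yb|//]; first by rewrite nc0.
exact: le_trans (ncD _ _) (lerD xa yb).
Qed.

Lemma poly_bounded p : exists2 H, 0 < H & forall w, nc w <= 1 -> nc p.[w] <= H.
Proof.
exists (1 + \sum_(i < size p) nc p`_i).
  by rewrite ltr_pwDl// sumr_ge0// => i _; apply: nc_ge0.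
move=> w w1; rewrite horner_coef; apply: le_trans (nc_sum _ _ _) _.
rewrite -[X in X <= _]add0r lerD// ler_sum// => i _.
rewrite ncM ncX -[X in _ <= X]mulr1 ler_wpM2l ?nc_ge0// exprn_ile1 ?nc_ge0//.
Qed.

Lemma poly_lipschitz0 p : exists2 H, 0 < H &
  forall w, nc w <= 1 -> nc (p.[w] - p.[0]) <= H * nc w.
Proof.
have /factor_theorem[q pq] : root (p - p.[0]%:P) 0.
  by rewrite /root !hornerE subrr.
have [H H0 hH] := poly_bounded q; exists H => // w /hH hw.
have -> : p.[w] - p.[0] = q.[w] * w.
  by have := congr1 (fun p => p.[w]) pq; rewrite !hornerE subr0.
by rewrite ncM ler_wpM2r ?nc_ge0.
Qed.

Lemma near_root p rs eta : p != 0 -> p = lead_coef p *: \prod_(r <- rs) ('X - r%:P) ->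
  0 < eta -> exists2 eps, 0 < eps &
  forall w, nc p.[w] <= eps -> exists2 r, r \in rs & nc (w - r) <= eta.
Proof.
move=> p0 pE eta0; have l0 : 0 < nc (lead_coef p) by rewrite nc_gt0 lead_coef_eq0.
have B0 : 0 < nc (lead_coef p) * eta ^+ size rs by rewrite mulr_gt0 ?exprn_gt0.
(* A point farther than eta from every root has a value of modulus at least |lc| eta^deg; halving
   this makes the contradiction strict. *)
exists (nc (lead_coef p) * eta ^+ size rs / 2); first by rewrite divr_gt0.
move=> w; apply: contra_leP => hw.
have far r : r \in rs -> eta < nc (w - r).
  move=> rr; rewrite ltNge; apply/negP => le; apply: hw; by exists r.
apply: (@lt_le_trans _ _ (nc (lead_coef p) * eta ^+ size rs)); first by lra.
rewrite {2}pE hornerZ ncM ler_wpM2l ?nc_ge0//.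
elim: rs far {pE B0 hw} => [|r rs IH] far; first by rewrite big_nil hornerC nc1.
rewrite big_cons hornerM ncM exprS !hornerE ler_pM ?exprn_ge0 ?(ltW eta0)//.
  by rewrite ltW// far// mem_head.
by apply: IH => r' r'r; apply: far; rewrite in_cons r'r orbT.
Qed.

(* Near the unit circle [w |-> w ^+ z] is expanding. *)
Lemma pow_expanding (z : nat) : (1 < z)%N -> exists2 M, 0 < M & forall u r,
  nc u = 1 -> nc (u - r) <= 1 ->
  nc (u ^+ z - r ^+ z) <= M * nc (u - r) /\
  nc (u - r) * (2 - M * nc (u - r)) <= nc (u ^+ z - r ^+ z).
Proof.
(* Since |r| <= 2, the powers of r up to the z-th are at most 2^z. One factor z comes from a
   geometric sum, the other from summing z differences u^i - r^i. *)
move=> z1; pose M : R := 2 ^+ z * z%:R * z%:R.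
have z0 : (0 : R) < z%:R by rewrite ltr0n; lia.
have z1' : (2 : R) <= z%:R by rewrite ler_nat.
exists M; first by rewrite !mulr_gt0// exprn_gt0.
move=> u r u1 ur; have r2 : nc r <= 2.
  have -> : r = u - (u - r) by ring.
  by apply: le_trans (ncB _ _) _; rewrite u1; lra.
have r0 := nc_ge0 r.
have powr2 i : (i <= z)%N -> nc r ^+ i <= 2 ^+ z.
  move=> iz; apply: (@le_trans _ _ (2 ^+ i)); first by rewrite lerXn2r ?nnegrE.
  by rewrite ler_eXn2l//; lra.
have geom i : (i <= z)%N -> nc (\sum_(j < i) u ^+ (i.-1 - j) * r ^+ j) <= 2 ^+ z * z%:R.
  move=> iz; apply: le_trans (nc_sum _ _ _) _.
  apply: (@le_trans _ _ (\sum_(j < i) 2 ^+ z)).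
    by apply: ler_sum => j _; rewrite ncM !ncX u1 expr1n mul1r powr2//; have := ltn_ord j; lia.
  by rewrite sumr_const card_ord -[_ *+ i]mulr_natr ler_wpM2l ?exprn_ge0// ler_nat.
have P0 : (0 : R) < 2 ^+ z by rewrite exprn_gt0.
rewrite subrXX ncM; set S := \sum_(i < z) _; set e := nc (u - r).
have e0 : 0 <= e by apply: nc_ge0.
have SE : S = \sum_(i < z) u ^+ (z.-1 - i) * r ^+ i.
  by apply: eq_bigr => i _; rewrite -subn1 subnAC subn1.
have hS : nc S <= 2 ^+ z * z%:R by rewrite SE; apply: geom.
split.
  rewrite mulrC ler_wpM2r//; apply: le_trans hS _; rewrite /M ler_peMr//; last by lra.
  by rewrite mulr_ge0//; lra.
rewrite ler_wpM2l//.
(* The difference quotient S is close to the derivative z u^(z-1), whose modulus is z >= 2. *)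
have hd : nc (u ^+ z.-1 *+ z - S) <= M * e.
  have -> : u ^+ z.-1 *+ z - S = \sum_(i < z) u ^+ (z.-1 - i) * (u ^+ i - r ^+ i).
    rewrite SE -[X in _ *+ X]card_ord -sumr_const -sumrB; apply: eq_bigr => i _.
    by rewrite mulrBr -exprD subnK//; have := ltn_ord i; lia.
  apply: le_trans (nc_sum _ _ _) _.
  apply: (@le_trans _ _ (\sum_(i < z) 2 ^+ z * z%:R * e)).
    apply: ler_sum => i _; rewrite ncM ncX u1 expr1n mul1r subrXX ncM mulrC.
    rewrite ler_wpM2r//; have := geom i (ltnW (ltn_ord i)).
    congr (nc _ <= _); apply: eq_bigr => j _; by rewrite -subn1 subnAC subn1.
  rewrite sumr_const card_ord -[_ *+ z]mulr_natr /M.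
  by rewrite [2 ^+ z * z%:R * e * z%:R]mulrAC.
have : nc (u ^+ z.-1 *+ z) <= nc (u ^+ z.-1 *+ z - S) + nc S.
  have {1}-> : u ^+ z.-1 *+ z = (u ^+ z.-1 *+ z - S) + S by ring.
  exact: ncD.
have -> : nc (u ^+ z.-1 *+ z) = z%:R.
  rewrite -[_ *+ z]mulr_natr ncM ncX u1 expr1n mul1r.
  by rewrite -(rmorph_nat (real_complex R) z) ncR// ler0n.
lra.
Qed.

(** A shadowing argument. If eta is small against the gaps between the points r^z and [rs], the
    nearby points satisfy r_(t+1) = r_t^z exactly. The distance to them then grows by a factor 3/2
    at each step while staying below eta, so it is 0. *)
Lemma pow_dynamics (z : nat) (rs : seq C) : (1 < z)%N -> exists2 eta, 0 < eta &
  forall u, nc u = 1 ->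
   (forall t, exists2 r, r \in rs & nc (u ^+ (z ^ t) - r) <= eta) ->
  forall t, u ^+ (z ^ t) \in rs.
Proof.
move=> z1; have [M M0 hM] := pow_expanding z1.
have [b b0 hb] : exists2 b, 0 < b & forall r r', r \in rs -> r' \in rs ->
    r ^+ z != r' -> b <= nc (r ^+ z - r').
  have [b b0 hb] := @finite_lower_bound R ('I_(size rs) * 'I_(size rs))%type
    (fun ij => rs`_ij.1 ^+ z != rs`_ij.2) (fun ij => nc (rs`_ij.1 ^+ z - rs`_ij.2))
    (fun ij h => ltac:(by rewrite nc_gt0 subr_eq0)).
  exists b => // r r' rr rr' ne.
  have i1 : (index r rs < size rs)%N by rewrite index_mem.
  have i2 : (index r' rs < size rs)%N by rewrite index_mem.
  by have := hb (Ordinal i1, Ordinal i2); rewrite /= !nth_index//; apply.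
(* The second bound makes the expansion factor 2 - M e at least 3/2; the third gives (M + 1) eta <
   b, which forces r_(t+1) = r_t^z. *)
exists (Num.min 1 (Num.min (M^-1 / 2) (b / (M + 1) / 2))).
  by rewrite !lt_min ltr01 !divr_gt0 ?invr_gt0//; lra.
set eta := Num.min _ _.
have e1 : eta <= 1 by rewrite ge_min lexx.
have e2 : M * eta <= 1 / 2.
  have : eta <= M^-1 / 2 by rewrite !ge_min lexx orbT.
  rewrite -(ler_pM2l M0) mulrA mulfV; [lra|by apply: lt0r_neq0].
have e3 : (M + 1) * eta < b.
  have : eta <= b / (M + 1) / 2 by rewrite !ge_min lexx !orbT.
  have M1 : 0 < M + 1 by lra.
  rewrite -(ler_pM2l M1) mulrA [(M + 1) * (b / _)]mulrC divfK; [lra|by apply: lt0r_neq0].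
move: eta e1 e2 e3 => eta e1 e2 e3.
suff key u : nc u = 1 ->
   (forall t, exists2 r, r \in rs & nc (u ^+ (z ^ t) - r) <= eta) -> u \in rs.
  move=> u u1 hu t; apply: key; first by rewrite ncX u1 expr1n.
  by move=> t'; have [r rr hr] := hu (t + t')%N; exists r => //; rewrite -exprM -expnD.
move=> u1 hu; have {}hu t : exists r, r \in rs /\ nc (u ^+ (z ^ t) - r) <= eta.
  by have [r] := hu t; exists r.
have [r hr] := choice hu.
pose e t := nc (u ^+ (z ^ t) - r t).
have ut t : nc (u ^+ (z ^ t)) = 1 by rewrite ncX u1 expr1n.
have he t : e t <= eta by have [] := hr t.
have rS t : r t.+1 = r t ^+ z.
  apply/eqP; rewrite eq_sym; apply: contraT => ne.
  have := hb _ _ (hr t).1 (hr t.+1).1 ne; rewrite leNgt => /negP[].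
  apply: le_lt_trans e3.
  have [h1 _] := hM _ _ (ut t) (le_trans (he t) e1).
  have -> : r t ^+ z - r t.+1 =
     (u ^+ (z ^ t.+1) - r t.+1) - ((u ^+ (z ^ t)) ^+ z - r t ^+ z).
    by rewrite -exprM -expnSr; ring.
  apply: le_trans (ncB _ _) _; have := he t.+1; have := he t; rewrite /e in h1 *.
  move: (nc _) (nc _) (nc _) h1 => A B D; nra.
have eS t : 3 / 2 * e t <= e t.+1.
  have [_ h2] := hM _ _ (ut t) (le_trans (he t) e1).
  rewrite {2}/e rS expnSr exprM; apply: le_trans h2; have := he t.
  rewrite /e; have := nc_ge0 (u ^+ (z ^ t) - r t); move: (nc _) => A A0 hA.
  have MA : 0 <= 1 / 2 - M * A.
    by rewrite subr_ge0; apply: le_trans e2; rewrite ler_pM2l.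
  have := mulr_ge0 A0 MA; lra.
have et t : (3 / 2) ^+ t * e 0%N <= e t.
  elim: t => [|t IH]; first by rewrite expr0 mul1r.
  apply: le_trans (eS t); rewrite exprS -mulrA; lra.
have [e00|/eqP] := eqVneq (e 0%N) 0.
  move/eqP: e00; rewrite /e nc_eq0 subr_eq0 expn0 expr1 => /eqP->.
  by have [] := hr 0%N.
have := nc_ge0 (u ^+ (z ^ 0) - r 0%N); rewrite -/(e 0%N) le_eqVlt => /orP[/eqP->//|e0 _].
have x1 : (1 : R) < 3 / 2 by lra.
have [t] := expr_unbounded (1 / e 0%N) x1.
rewrite ltr_pdivrMr// => ht; have := et t; have := he t; lra.
Qed.
End ComplexNorm.

(** * Plane curves invariant under the power map *)

Section PowerInvariantCurve.
Variables (R : realType) (z m : nat) (P : pred 'I_m) (a : 'I_m -> nat).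
Local Notation C := R[i].
Local Notation nc := (@ComplexField.Normc.normc R).
Variable k : 'I_m -> {poly C}.
Hypothesis z1 : (1 < z)%N.
Hypothesis k0 : forall j, P j -> (k j).[0] != 0.
Hypothesis Pn0 : exists j, P j.

(* The curve is [\sum_j g_j(S) Y^j = 0] with [g_j = S^(a j) k_j(S)], [k_j(0) <> 0]. *)
Definition curve (s : R) (y : C) :=
  \sum_(j < m | P j) (k j).[s%:C%C] * (s%:C%C ^+ a j * y ^+ j).

(** Modulus of S^(a j) Y^j at (s,y). Along the orbit it is raised to the power z^t, so the
    comparison of these numbers decides which terms survive. *)
Definition slope_size (s : R) (y : C) (j : 'I_m) : R := s ^+ a j * nc y ^+ j.

Lemma slope_size_gt0 s y j : 0 < s -> y != 0 -> 0 < slope_size s y j.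
Proof. by move=> s0 y0; rewrite mulr_gt0 ?exprn_gt0 ?nc_gt0. Qed.

Lemma nc_term (s : R) (y : C) j : 0 < s -> nc (s%:C%C ^+ a j * y ^+ j) = slope_size s y j.
Proof. by move=> s0; rewrite ncM !ncX ncR// ltW. Qed.

Lemma nc_pow_le1 (s : R) N : 0 < s < 1 -> nc (s ^+ N)%:C%C <= 1.
Proof.
move=> /andP[s0 s1]; rewrite ncR ?exprn_ge0 ?(ltW s0)//.
by rewrite exprn_ile1 ?(ltW s0) ?(ltW s1).
Qed.

Lemma coef_bounds : exists2 H, 0 < H & forall j w, nc w <= 1 ->
  nc (k j).[w] <= H /\ nc ((k j).[w] - (k j).[0]) <= H * nc w.
Proof.
have h1 j : exists H, 0 < H /\ forall w, nc w <= 1 -> nc (k j).[w] <= H.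
  by have [H] := poly_bounded (k j); exists H.
have h2 j : exists H, 0 < H /\ forall w, nc w <= 1 ->
    nc ((k j).[w] - (k j).[0]) <= H * nc w.
  by have [H] := poly_lipschitz0 (k j); exists H.
have [H1 hH1] := choice h1; have [H2 hH2] := choice h2.
have [B1 B10 hB1] := finite_upper_bound H1.
have [B2 B20 hB2] := finite_upper_bound H2.
exists (B1 + B2); first by rewrite addr_gt0.
move=> j w w1; split.
  apply: le_trans ((hH1 j).2 w w1) _; apply: le_trans (hB1 j) _; lra.
apply: le_trans ((hH2 j).2 w w1) _; rewrite ler_wpM2r ?nc_ge0//.
by apply: le_trans (hB2 j) _; lra.
Qed.

(** If a single term had the largest size, its share of the vanishing sum would dominate at late
    times, because its coefficient tends to [(k j).[0]], which is not 0. *)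
Lemma curve_tie s y : 0 < s < 1 -> y != 0 ->
  (forall t, curve (s ^+ (z ^ t)) (y ^+ (z ^ t)) = 0) ->
  exists j1 j2 : 'I_m, [/\ P j1, P j2, (j1 < j2)%N,
    slope_size s y j1 = slope_size s y j2 &
    forall j, P j -> slope_size s y j <= slope_size s y j1].
Proof.
move=> s01 y0 hc; have /andP[s0 s1] := s01; have [j0 Pj0] := Pn0.
pose mu := slope_size s y.
have mu0 j : 0 < mu j by apply: slope_size_gt0.
have [js Pjs jmax] := arg_maxP mu Pj0.
have [[i [Pi ij ei]]|nex] := pselect (exists i, [/\ P i, i != js & mu i = mu js]).
  have [lt|gt|e] := ltngtP i js.
  - by exists i, js; split=> // j Pj; rewrite -/(mu i) ei; apply: jmax.
  - by exists js, i; split=> // j Pj; apply: jmax.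
  - by rewrite (val_inj e) eqxx in ij.
have lt i : P i && (i != js) -> 0 < 1 - mu i / mu js.
  move=> /andP[Pi ij]; rewrite subr_gt0 ltr_pdivrMr// mul1r lt_neqAle.
  have -> /= : mu i <= mu js by apply: jmax.
  by rewrite andbT; apply/eqP => e; apply: nex; exists i.
have [b b0 hb] := finite_lower_bound lt.
(* One rate for both errors: the ratios of the other terms to the largest, and s itself, which
   controls how far [k j] is from its value at 0. *)
pose rho := Num.max s (1 - b).
have rho0 : 0 < rho by rewrite lt_max s0.
have rho1 : rho < 1 by rewrite gt_max s1; lra.
have srho : s <= rho by rewrite le_max lexx.
have mrho i : P i && (i != js) -> mu i <= rho * mu js.
  move=> hi; rewrite -ler_pdivrMr//; apply: (@le_trans _ _ (1 - b)).
    by have := hb _ hi; lra.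
  by rewrite le_max lexx orbT.
have [H H0 hH] := coef_bounds.
pose A := m%:R * H + H.
have A0 : 0 < A by rewrite ltr_wpDl// mulr_ge0 ?(ltW H0)// ler0n.
have c0 : 0 < nc (k js).[0] by rewrite nc_gt0 k0.
have [t ht] := @expr_small R rho (nc (k js).[0] / A)
  (introT andP (conj (ltW rho0) rho1)) (divr_gt0 c0 A0).
exfalso; set N := (z ^ t)%N.
have tN : rho ^+ N <= rho ^+ t.
  by rewrite ler_wiXn2l ?ltW// ltnW// /N ltn_expl.
have {tN}ht : rho ^+ N < nc (k js).[0] / A by apply: le_lt_trans ht.
move: (hc t); rewrite -/N /curve (bigD1 js)//= => /eqP; rewrite addr_eq0 => /eqP eqt.
have sN0 : 0 < s ^+ N by rewrite exprn_gt0.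
have sN1 : nc (s ^+ N)%:C%C <= 1 by apply: nc_pow_le1.
have termN j : nc ((s ^+ N)%:C%C ^+ a j * (y ^+ N) ^+ j) = mu j ^+ N.
  by rewrite nc_term// /mu /slope_size ncX exprMn -!exprM [(a j * _)%N]mulnC [(j * _)%N]mulnC.
have le1 : nc (k js).[(s ^+ N)%:C%C] <= m%:R * H * rho ^+ N.
  have muN0 : 0 < mu js ^+ N by rewrite exprn_gt0.
  rewrite -(ler_pM2r muN0) -{1}termN -ncM eqt ncN.
  apply: le_trans (nc_sum _ _ _) _.
  apply: (@le_trans _ _ (\sum_(j < m | P j && (j != js)) H * (rho ^+ N * mu js ^+ N))).
    apply: ler_sum => j hj; rewrite ncM termN.
    apply: ler_pM; rewrite ?nc_ge0 ?exprn_ge0 ?(ltW (mu0 _))//.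
      by have [] := hH j _ sN1.
    rewrite -exprMn; apply: lerXn2r; rewrite ?nnegrE; last exact: mrho.
      exact/ltW/mu0.
    by rewrite mulr_ge0// ltW.
  rewrite sumr_const -[_ *+ #|_|]mulr_natl !mulrA.
  do 2 (rewrite ler_wpM2r ?exprn_ge0 ?(ltW (mu0 _)) ?(ltW rho0)//).
  rewrite ler_wpM2r ?(ltW H0)// ler_nat.
  by apply: leq_trans (max_card _) _; rewrite card_ord.
have [_ le2] := hH js _ sN1.
have le3 : s ^+ N <= rho ^+ N by apply: lerXn2r; rewrite ?nnegrE// ltW.
have : nc (k js).[0] <= A * rho ^+ N.
  have -> : (k js).[0] = (k js).[(s ^+ N)%:C%C] - ((k js).[(s ^+ N)%:C%C] - (k js).[0]) by ring.
  apply: le_trans (ncB _ _) _; rewrite /A mulrDl lerD//.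
  by apply: le_trans le2 _; rewrite ler_pM2l// ncR// ltW.
by move: ht; rewrite ltr_pdivlMr// mulrC => /lt_le_trans h /h; rewrite ltxx.
Qed.

(** With d = j2 - j1, the tie makes |y|^d an integral power of s, hence also the d-th power of every
    slope size. Two different integral powers of s differ by a factor of at least 1/s. *)
Lemma slope_gap s y (j1 j2 j : 'I_m) : 0 < s < 1 -> y != 0 -> (j1 < j2)%N ->
  slope_size s y j1 = slope_size s y j2 -> slope_size s y j < slope_size s y j1 ->
  slope_size s y j ^+ (j2 - j1) <= s * slope_size s y j1 ^+ (j2 - j1).
Proof.
move=> /andP[s0 s1] y0 j12 e lt; set d := (j2 - j1)%N.
have d0 : (0 < d)%N by rewrite subn_gt0.
have sn0 : s != 0 by apply: lt0r_neq0.
set Y := nc y; have Y0 : 0 < Y by rewrite nc_gt0.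
have Yd : Y ^+ d = s ^ ((a j1)%:Z - (a j2)%:Z).
  rewrite expfzDr// -invr_expz -!exprnP.
  apply: (mulIf (expf_neq0 (a j2) sn0)); rewrite divfK ?expf_neq0//.
  apply: (mulIf (expf_neq0 j1 (lt0r_neq0 Y0))).
  rewrite mulrAC -exprD subnK; last exact: ltnW.
  by rewrite mulrC -[LHS]/(slope_size s y j2) -e.
have pw i : slope_size s y i ^+ d =
    s ^ ((a i * d)%:Z + ((a j1)%:Z - (a j2)%:Z) * i%:Z).
  rewrite exprMn -exprM -[(_ ^+ i) ^+ d]exprM [(i * d)%N]mulnC.
  by rewrite [_ ^+ (d * i)]exprM Yd [RHS]expfzDr// -exprz_exp.
have : slope_size s y j ^+ d < slope_size s y j1 ^+ d.
  by rewrite ltrXn2r ?nnegrE -?lt0n ?ltW ?slope_size_gt0// -lt0n.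
have sV A : s ^ A = s^-1 ^ (- A) by rewrite exprz_inv opprK.
have sV1 : 1 < s^-1 by rewrite invf_gt1.
rewrite !pw; move: (_ + _) (_ + _) => A B.
rewrite !sV ltr_eXz2l// => BA.
rewrite -{2}(expr1z s) sV -expfzDr ?invr_neq0// ler_eXz2l//; lia.
Qed.

(** For [J] the indices of maximal slope size, this is the part of the equation on one edge of the
    Newton polygon, to be evaluated at powers of y/|y|. *)
Definition edge_poly (J : {set 'I_m}) : {poly C} :=
  \sum_(j in J) (k j).[0] *: 'X^j.

Lemma edge_poly_coef (J : {set 'I_m}) (j : 'I_m) : j \in J -> (edge_poly J)`_j = (k j).[0].
Proof.
move=> jJ; rewrite coef_sum (bigD1 j)//= coefZ coefXn eqxx mulr1 big1 ?addr0//.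
by move=> i /andP[_ ij]; rewrite coefZ coefXn eq_sym (inj_eq val_inj) (negbTE ij) mulr0.
Qed.

Lemma size_edge_poly J : (size (edge_poly J) <= m)%N.
Proof.
apply: leq_trans (size_sum _ _ _) _; apply/bigmax_leqP => j _.
apply: leq_trans (size_scale_leq _ _) _.
by rewrite size_polyXn.
Qed.

Lemma power_invariant_curve : exists2 s0, 0 < s0 & forall s y, 0 < s < s0 -> y != 0 ->
  (forall t, curve (s ^+ (z ^ t)) (y ^+ (z ^ t)) = 0) ->
  exists (j1 j2 : 'I_m) (N : nat), [/\ P j1, P j2, (j1 < j2)%N, (0 < N <= z ^ m.-1)%N &
    (s%:C%C ^+ a j1 * y ^+ j1) ^+ N = (s%:C%C ^+ a j2 * y ^+ j2) ^+ N].
Proof.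
pose rs (J : {set 'I_m}) := sval (closed_field_poly_normal (edge_poly J)).
have rsE J : edge_poly J = lead_coef (edge_poly J) *: \prod_(r <- rs J) ('X - r%:P).
  exact: svalP (closed_field_poly_normal (edge_poly J)).
pose good (J : {set 'I_m}) := (J != finset.set0) && [forall j in J, P j].
have goodE J : good J -> edge_poly J != 0.
  move=> /andP[/set0Pn[j jJ] /forall_inP JP]; apply/eqP => e.
  by have := k0 (JP j jJ); rewrite -(edge_poly_coef jJ) e coef0 eqxx.
have size_rs J : good J -> (size (rs J) <= m.-1)%N.
  move=> /goodE E0; have := size_edge_poly J; rewrite {1}rsE size_scale ?lead_coef_eq0//.
  by rewrite size_prod_XsubC; case: (m).
have exeps J : exists eps, 0 < eps /\ (good J -> forall u, nc u = 1 ->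
    (forall t, nc (edge_poly J).[u ^+ (z ^ t)] <= eps) ->
    forall t, u ^+ (z ^ t) \in rs J).
  have [gJ|ngJ] := boolP (good J); last by exists 1.
  have [eta eta0 heta] := pow_dynamics (rs J) z1.
  have [eps eps0 heps] := near_root (goodE _ gJ) (rsE J) eta0.
  exists eps; split=> // _ u u1 hu; apply: heta => // t; exact: heps.
have [eps heps] := choice exeps.
(* The set J of maximal terms depends on (s,y), so the tolerance is made uniform over all
   subsets. *)
have [e e0 he] := @finite_lower_bound R {set 'I_m} xpredT eps (fun J _ => (heps J).1).
have [H H0 hH] := coef_bounds.
have m0 : (0 < m)%N by case: Pn0 => j _; apply: leq_ltn_trans (ltn_ord j).
pose A : R := m%:R * H.
have A0 : 0 < A by rewrite mulr_gt0// ltr0n.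
pose eta := Num.min (1 / 2) (e / A).
have eta0 : 0 < eta by rewrite lt_min !divr_gt0.
have eta1 : eta < 1 by rewrite gt_min; apply/orP; left; lra.
have etaA : A * eta <= e.
  by rewrite mulrC -ler_pdivlMr// ge_min lexx orbT.
(* [slope_gap] bounds only the d-th power of the ratios by s; as d <= m and s < eta^m, the ratios
   themselves are at most eta. *)
exists (eta ^+ m); first by rewrite exprn_gt0.
move=> s y /andP[s0 seta] y0 hc.
have seta' : s <= eta.
  apply: le_trans (ltW seta) _; rewrite -[X in _ <= X]expr1.
  by rewrite ler_wiXn2l// ltW.
have s1 : s < 1 by apply: le_lt_trans eta1.
have s01 : 0 < s < 1 by rewrite s0.
have [j1 [j2 [Pj1 Pj2 j12 tie jmax]]] := curve_tie s01 y0 hc.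
pose mu := slope_size s y.
have mu0 j : 0 < mu j by apply: slope_size_gt0.
pose J : {set 'I_m} := [set j | P j && (mu j == mu j1)]%SET.
have gJ : good J.
  apply/andP; split; first by apply/set0Pn; exists j1; rewrite inE Pj1 eqxx.
  by apply/forall_inP => j; rewrite inE => /andP[].
pose ny : C := (nc y)%:C%C; have ncy0 : 0 < nc y by rewrite nc_gt0.
have ny0 : ny != 0 by rewrite -nc_eq0 ncR ?ltW// lt0r_neq0.
pose u := y / ny.
have u1 : nc u = 1 by rewrite ncM ncV ncR ?ltW// mulfV// lt0r_neq0.
have ratio j : P j -> j \notin J -> mu j / mu j1 <= eta.
  move=> Pj; rewrite inE Pj/= => ne.
  have lt : mu j < mu j1 by rewrite lt_neqAle ne jmax.
  have := slope_gap s01 y0 j12 tie lt; rewrite -/(mu j) -/(mu j1); set d := (_ - _)%N.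
  rewrite -ler_pdivrMr ?exprn_gt0// -expr_div_n => hd; rewrite leNgt; apply/negP => gt.
  have : eta ^+ d < s.
    by apply: lt_le_trans hd; rewrite ltrXn2r ?(ltW eta0)// -lt0n subn_gt0.
  apply/negP; rewrite -leNgt; apply: le_trans (ltW seta) _.
  rewrite ler_wiXn2l// ?(ltW eta0) ?(ltW eta1)//.
  exact: leq_trans (leq_subr _ _) (ltnW (ltn_ord j2)).
have small t : nc (edge_poly J).[u ^+ (z ^ t)] <= eps J.
  apply: le_trans (he J isT); apply: le_trans etaA.
  set N := (z ^ t)%N; have N0 : (0 < N)%N by rewrite expn_gt0 (ltnW z1).
  have sN1 : nc (s ^+ N)%:C%C <= 1 by apply: nc_pow_le1.
  have sNs : s ^+ N <= s.
    by rewrite -[X in _ <= X]expr1 ler_wiXn2l// ltW.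
  have muN0 : (mu j1 ^+ N)%:C%C != 0 :> C.
    by rewrite -nc_eq0 ncR ?exprn_ge0 ?ltW// lt0r_neq0// exprn_gt0.
  pose v j : C := ((s ^+ N)%:C%C ^+ a j * (y ^+ N) ^+ j) / (mu j1 ^+ N)%:C%C.
  have ncv j : nc (v j) = (mu j / mu j1) ^+ N.
    rewrite ncM ncV ncR ?exprn_ge0 ?ltW// nc_term ?exprn_gt0//.
    rewrite expr_div_n; congr (_ / _).
    by rewrite /mu /slope_size ncX exprMn -!exprM [(a j * _)%N]mulnC [(j * _)%N]mulnC.
  have vJ j : j \in J -> v j = (u ^+ N) ^+ j.
    rewrite inE => /andP[_ /eqP muj]; rewrite /v -muj.
    have -> : ((s ^+ N)%:C ^+ a j = (s%:C ^+ a j) ^+ N)%C by rewrite rmorphXn exprAC.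
    have -> : (mu j ^+ N)%:C%C = (s%:C%C ^+ a j) ^+ N * (ny ^+ j) ^+ N.
      by rewrite rmorphXn rmorphM !rmorphXn exprMn.
    rewrite [(y ^+ N) ^+ j]exprAC [RHS]exprAC /u !expr_div_n -mulf_div divff ?mul1r//.
    by rewrite !expf_neq0// -nc_eq0 ncR ?lt0r_neq0// ltW.
  have sum0 : \sum_(j < m | P j) (k j).[(s ^+ N)%:C%C] * v j = 0.
    rewrite (eq_bigr (fun j => (k j).[(s ^+ N)%:C%C] *
        ((s ^+ N)%:C%C ^+ a j * (y ^+ N) ^+ j) / (mu j1 ^+ N)%:C%C)).
      by rewrite -mulr_suml -/(curve _ _) hc mul0r.
    by move=> j _; rewrite mulrA.
  (* Subtract the normalized curve equation, which is 0. On J there remains the change of a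
     coefficient between 0 and s^N, off J a term of relative size at most eta. *)
  have -> : (edge_poly J).[u ^+ N] = \sum_(j < m | P j)
      ((if j \in J then (k j).[0] * v j else 0) - (k j).[(s ^+ N)%:C%C] * v j).
    rewrite sumrB sum0 subr0 -big_mkcondr/= horner_sum.
    rewrite [LHS](eq_bigl (fun j => P j && (j \in J))); last first.
      by move=> j; rewrite inE; case: (P j).
    by apply: eq_bigr => j /andP[_ jJ]; rewrite hornerZ hornerXn vJ.
  apply: le_trans (nc_sum _ _ _) _.
  apply: (@le_trans _ _ (\sum_(j < m | P j) H * eta)).
    apply: ler_sum => j Pj; have [b1 b2] := hH j _ sN1.
    case: ifPn => jJ.
      rewrite -mulrBl ncM nc_distC ncv; move: jJ; rewrite inE => /andP[_ /eqP->].
      rewrite divff ?lt0r_neq0// expr1n mulr1; apply: le_trans b2 _.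
      by rewrite ler_pM2l// ncR ?exprn_ge0 ?(ltW s0)//; apply: le_trans sNs _.
    rewrite sub0r ncN ncM ncv; apply: ler_pM => //; rewrite ?nc_ge0//.
      by rewrite exprn_ge0// divr_ge0// ltW.
    have r1 := ratio j Pj jJ; apply: le_trans r1.
    rewrite -[X in _ <= X]expr1 ler_wiXn2l// ?divr_ge0 ?(ltW (mu0 _))//.
    by apply: le_trans (ratio j Pj jJ) _; apply: ltW.
  rewrite sumr_const -[_ *+ #|_|]mulr_natl /A -mulrA ler_wpM2r//.
    by rewrite mulr_ge0// ltW.
  by rewrite ler_nat; apply: leq_trans (max_card _) _; rewrite card_ord.
have inrs := (heps J).2 gJ u u1 small.
(* Pigeonhole: m powers of u lie among at most m - 1 roots, so u is a root of unity of order
   dividing z^k2 - z^k1. *)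
have [k1 [k2 [k12 k2m ek]]] : exists k1 k2, [/\ (k1 < k2)%N, (k2 <= m.-1)%N &
    u ^+ (z ^ k1) = u ^+ (z ^ k2)].
  pose l := [seq u ^+ (z ^ i) | i <- iota 0 m].
  have sl : size l = m by rewrite size_map size_iota.
  have /(uniqPn 0)[k1 [k2 [k12]]] : ~~ uniq l.
    apply/negP => ul; suff : (m <= m.-1)%N by rewrite leqNgt ltn_predL m0.
    rewrite -{1}sl; apply: leq_trans (uniq_leq_size ul _) (size_rs _ gJ).
    by move=> w /mapP[t _ ->].
  rewrite sl => k2m; rewrite !(nth_map 0%N) ?size_iota ?(ltn_trans k12)// => e12.
  exists k1, k2; split=> //; first by rewrite -ltnS prednK.
  by move: e12; rewrite !nth_iota// (ltn_trans k12).
have kk : (z ^ k1 < z ^ k2)%N by rewrite ltn_exp2l.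
pose N := (z ^ k2 - z ^ k1)%N.
have uN : u ^+ N = 1.
  have un0 : u != 0 by rewrite -nc_eq0 u1 oner_eq0.
  apply: (mulIf (expf_neq0 (z ^ k1) un0)).
  by rewrite -exprD subnK ?mul1r ?ek// ltnW.
exists j1, j2, N; split=> //.
  rewrite subn_gt0 kk/=; apply: leq_trans (leq_subr _ _) _.
  by rewrite leq_exp2l.
(* After the N-th power both tied terms are positive reals, so equality of moduli becomes
   equality. *)
have yN : y ^+ N = ny ^+ N by rewrite -{1}(divfK ny0 y) exprMn -/u uN mul1r.
have tN j : (s%:C%C ^+ a j * y ^+ j) ^+ N = (mu j ^+ N)%:C%C.
  rewrite exprMn -[(y ^+ j) ^+ N]exprM mulnC exprM yN /mu /slope_size.
  by rewrite exprMn rmorphM/= !rmorphXn/= -/ny -!exprM [(N * j)%N]mulnC.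
by rewrite !tN /mu tie.
Qed.
End PowerInvariantCurve.

(** * Invariant hypersurfaces *)

Section PseudoDivision.
Let ar1 (a b j : nat) : (a <= b)%N -> (b <= j)%N -> (a <= j - (b - a))%N.
Proof. by lia. Qed.
Let ar2 (b j m : nat) : (b <= m.+1)%N -> (m <= j)%N -> (j < b)%N -> j = b.-1.
Proof. by lia. Qed.
Let ar3 (a b j : nat) : (0 < a)%N -> (a <= b)%N -> j = b.-1 ->
  (j < b - a)%N = false /\ (j - (b - a) = a.-1)%N.
Proof. by lia. Qed.
Variables (A : idomainType) (B : nat -> A -> Prop).
Hypothesis B_mono : forall D D' a, (D <= D')%N -> B D a -> B D' a.
Hypothesis B_sub : forall D a b, B D a -> B D b -> B D (a - b).
Hypothesis B_mul : forall D D' a b, B D a -> B D' b -> B (D + D') (a * b).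
Hypothesis B0 : forall D, B D 0.

(** [B D a] abstracts a degree bound on coefficients. Each of the at most m cancellations multiplies
    by coefficients of f and costs D. *)
Lemma pseudo_division (f : {poly A}) D : f != 0 -> (forall j, B D f`_j) ->
  forall m (p : {poly A}) P, (size p <= m)%N -> (forall j, B P p`_j) ->
  exists k (q r : {poly A}), [/\ lead_coef f ^+ k *: p = q * f + r,
    (size r < size f)%N & forall j, B (P + m * D) r`_j].
Proof.
move=> f0 fB; elim=> [|m IH] p P sp pB.
  exists 0%N, 0, 0; split=> [||j]; rewrite ?coef0 ?size_poly0 ?size_poly_gt0//.
  by move: sp; rewrite leqn0 size_poly_eq0 => /eqP->; rewrite mul0r addr0 scaler0.
have [lt|le] := ltnP (size p) (size f).
  exists 0%N, 0, p; split=> // [|j]; first by rewrite expr0 scale1r mul0r add0r.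
  by apply: B_mono (pB j); apply: leq_addr.
set e := (size p - size f)%N.
pose p' := lead_coef f *: p - (lead_coef p *: 'X^e) * f.
have sf : (0 < size f)%N by rewrite size_poly_gt0.
have cE j : (lead_coef p *: 'X^e * f)`_j = lead_coef p * (if (j < e)%N then 0 else f`_(j - e)).
  by rewrite -scalerAl coefZ coefXnM.
have p'c j : p'`_j = lead_coef f * p`_j - lead_coef p * (if (j < e)%N then 0 else f`_(j - e)).
  by rewrite coefB coefZ cE.
have sp' : (size p' <= m)%N.
  apply/leq_sizeP => j mj; rewrite p'c.
  have [jp|pj] := ltnP j (size p); last first.
    rewrite (nth_default 0 pj) mulr0; case: ifPn => [_|_]; first by rewrite mulr0 subr0.
    by rewrite nth_default ?mulr0 ?subr0//; apply: ar1.
  have ej : j = (size p).-1 by apply: ar2 sp mj jp.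
  have [-> ->] : (j < e)%N = false /\ (j - e = (size f).-1)%N by apply: ar3.
  by rewrite ej -!lead_coefE mulrC subrr.
have [|k [q [r [eq sr rB]]]] := IH p' (P + D)%N sp'.
  move=> j; rewrite p'c; apply: B_sub; first by rewrite addnC; apply: B_mul; [exact: fB|exact: pB].
  apply: B_mul; first exact: pB.
  by case: ifP.
exists k.+1, (q + lead_coef f ^+ k *: (lead_coef p *: 'X^e)), r; split=> // [|j].
  rewrite mulrDl addrAC -eq -scalerAl /p' exprSr -scalerA -scalerDr.
  by congr (_ *: _); rewrite subrK.
by apply: B_mono (rB j); rewrite mulSn addnA.
Qed.
End PseudoDivision.

(** * Iterated polynomial rings, monomial curves and the divisibility argument *)

Section IteratedPoly.
Variable R : realType.
Local Notation C := R[i].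
Local Notation nc := (@ComplexField.Normc.normc R).

(* [ip n] is C[X_0, ..., X_(n-1)], as univariate polynomials in X_(n-1). *)
Fixpoint ip (n : nat) : idomainType := if n is m.+1 then {poly (ip m)} else C.

Section Eval.
Variables (A : comNzRingType) (c : {rmorphism C -> A}) (x : nat -> A).
(** The target ring is arbitrary so that evaluation at points and restriction to monomial curves are
    instances of one map and compose by [iev_comp]. *)
Fixpoint iev (n : nat) : {rmorphism ip n -> A} :=
  match n return {rmorphism ip n -> A} with
  | 0 => c
  | m.+1 => horner_eval (x m) \o map_poly (iev m)
  end.
Lemma ievS n (f : {poly ip n}) : iev n.+1 f = (map_poly (iev n) f).[x n].
Proof. by []. Qed.
End Eval.

Lemma iev_ext (A : comNzRingType) (c c' : {rmorphism C -> A}) (x x' : nat -> A) n f :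
  c =1 c' -> (forall i, (i < n)%N -> x i = x' i) -> iev c x n f = iev c' x' n f.
Proof.
elim: n f => [|n IH] f cc xx; first exact: cc.
rewrite !ievS xx//; congr (_.[_]); apply: eq_map_poly => a.
by apply: IH => // i ni; apply: xx; apply: leqW.
Qed.

Lemma iev_comp (A B : comNzRingType) (psi : {rmorphism A -> B}) c x n f :
  psi (iev c x n f) = iev (psi \o c) (psi \o x) n f.
Proof.
elim: n f => [|n IH] f //; rewrite !ievS -horner_map/= -map_poly_comp.
by congr (_.[_]); apply: eq_map_poly => a /=; rewrite IH.
Qed.

Definition ieval (x : nat -> C) n : {rmorphism ip n -> C} := iev idfun x n.

Lemma ievalS x n (f : {poly ip n}) : ieval x n.+1 f = (map_poly (ieval x n) f).[x n].
Proof. by []. Qed.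

Lemma ieval_polyC x n c : ieval x n.+1 (c%:P : {poly ip n}) = ieval x n c.
Proof. by rewrite ievalS map_polyC hornerC. Qed.

Lemma ieval_ext x x' n f : (forall i, (i < n)%N -> x i = x' i) ->
  ieval x n f = ieval x' n f.
Proof. by move=> xx; apply: iev_ext. Qed.

Section Subst.
Variable z : nat.

Fixpoint isub (n : nat) : {rmorphism ip n -> ip n} :=
  match n return {rmorphism ip n -> ip n} with
  | 0 => idfun
  | m.+1 => comp_poly 'X^z \o map_poly (isub m)
  end.

Lemma isubS n (f : {poly ip n}) : isub n.+1 f = map_poly (isub n) f \Po 'X^z.
Proof. by []. Qed.

Lemma ieval_isub x n f : ieval x n (isub n f) = ieval (fun i => x i ^+ z) n f.
Proof.
elim: n f => [|n IH] f //; rewrite isubS !ievalS map_comp_poly horner_comp.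
rewrite map_polyXn hornerXn -map_poly_comp; congr (_.[_]).
by apply: eq_map_poly => a /=; apply: IH.
Qed.
End Subst.

(* [bd D f]: all partial degrees of f are at most D. *)
Fixpoint bd (n D : nat) : ip n -> Prop :=
  match n return ip n -> Prop with
  | 0 => fun=> True
  | m.+1 => fun f : {poly ip m} => (size f <= D.+1)%N /\ forall j, bd D f`_j
  end.

Lemma bd_mono n D D' f : (D <= D')%N -> bd (n := n) D f -> bd D' f.
Proof.
elim: n f => //= n IH f DD [sf hf]; split; first exact: leq_trans sf _.
by move=> j; apply: IH.
Qed.

Lemma bd0 n D : bd (n := n) D 0.
Proof. by elim: n => //= n IH; split=> [|j]; rewrite ?size_poly0 ?coef0. Qed.

Lemma bd_add n D f g : bd (n := n) D f -> bd D g -> bd D (f + g).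
Proof.
elim: n f g => //= n IH f g [sf hf] [sg hg]; split=> [|j]; last by rewrite coefD; apply: IH.
by apply: leq_trans (size_polyD _ _) _; rewrite geq_max sf.
Qed.

Lemma bd_opp n D f : bd (n := n) D f -> bd D (- f).
Proof.
elim: n f => //= n IH f [sf hf]; split=> [|j]; first by rewrite size_polyN.
by rewrite coefN; apply: IH.
Qed.

Lemma bd_sum n D (I : Type) (r : seq I) (F : I -> ip n) :
  (forall i, bd D (F i)) -> bd D (\sum_(i <- r) F i).
Proof.
move=> hF; elim: r => [|i r IH]; first by rewrite big_nil; apply: bd0.
by rewrite big_cons; apply: bd_add.
Qed.

Lemma bd_mul n D D' f g : bd (n := n) D f -> bd D' g -> bd (D + D') (f * g).
Proof.
elim: n f g => //= n IH f g [sf hf] [sg hg]; split=> [|j].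
  have ar a b : (a <= D.+1)%N -> (b <= D'.+1)%N -> ((a + b).-1 <= (D + D').+1)%N.
    by clear; lia.
  exact: leq_trans (size_polyMleq _ _) (ar _ _ sf sg).
by rewrite coefM; apply: bd_sum => i; apply: IH.
Qed.

Lemma bd_isub z n D f : (0 < z)%N -> bd (n := n) D f -> bd (z * D) (isub z n f).
Proof.
move=> z0; elim: n f => // n IH f [sf hf]; rewrite isubS.
have cE j : (map_poly (isub z n) f \Po 'X^z)`_j =
    if (z %| j)%N then isub z n f`_(j %/ z) else 0.
  by rewrite coef_comp_poly_Xn//; case: ifP => // _; rewrite coef_map.
split=> [|j]; last by rewrite cE; case: ifP => _; [apply: IH; apply: hf|apply: bd0].
apply/leq_sizeP => j hj; rewrite cE; case: ifPn => // zj.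
rewrite nth_default ?rmorph0//; apply: leq_trans sf _.
rewrite leq_divRL//; case/dvdnP: zj hj => l ->; rewrite mulnC ltn_pmul2r// => h.
by rewrite leq_mul2r h orbT.
Qed.

Fixpoint im (n : nat) (u : nat -> nat) : ip n :=
  match n return ip n with
  | 0 => 1
  | m.+1 => (im m u)%:P * 'X^(u m)
  end.

Lemma ieval_im x n u : ieval x n (im n u) = \prod_(i < n) x i ^+ u i.
Proof.
elim: n => [|n IH]; first by rewrite rmorph1 big_ord0.
rewrite ievalS /= rmorphM/= map_polyC map_polyXn hornerM hornerC hornerXn.
by rewrite big_ord_recr/= IH.
Qed.

(* Restriction to the monomial curve X_i = S^(w i). *)
Definition kappa (w : nat -> nat) n : {rmorphism ip n -> {poly C}} :=
  iev polyC (fun i => 'X^(w i)) n.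

Lemma kappa_horner w n f s :
  (kappa w n f).[s] = ieval (fun i => s ^+ w i) n f.
Proof.
rewrite -[LHS]/(horner_eval s _) iev_comp; apply: iev_ext => [a|i _] /=.
  by rewrite /horner_eval hornerC.
by rewrite /horner_eval hornerXn.
Qed.

(** By induction on the variables: the polynomial left in the last variable has finitely many roots,
    so some power X^c is not a root. *)
Lemma kappa_neq0 n f : f != 0 -> exists w, kappa w n f != 0.
Proof.
elim: n f => [|n IH] f f0; first by exists (fun=> 0%N); rewrite polyC_eq0.
have [|w hw] := IH (lead_coef (f : {poly ip n})); first by rewrite lead_coef_eq0.
set F := map_poly (kappa w n) f.
have F0 : F != 0.
  apply: contra_neq hw => F0; rewrite lead_coefE -[LHS]coef_map.
  by rewrite -[map_poly _ _]/F F0 coef0.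
have [c hc] : exists c, F.['X^c] != 0.
  apply: contrapT => /forallNP nc.
  have : (size [seq 'X^c : {poly C} | c <- iota 0 (size F)] < size F)%N.
    apply: max_poly_roots => //.
      by apply/allP => _ /mapP[c _ ->]; apply/negPn/negP; apply: nc.
    rewrite map_inj_uniq ?iota_uniq// => c c' e.
    by have := congr1 (fun p : {poly C} => size p) e; rewrite !size_polyXn => -[].
  by rewrite size_map size_iota ltnn.
exists (fun i => if i == n then c else w i).
rewrite /kappa ievS eqxx; apply: contra_neq hc => e; rewrite -[RHS]e.
congr (_.[_]); apply: eq_map_poly => a; apply: iev_ext => // i ni.
by rewrite ltn_eqF.
Qed.

(** The weights w, hence the orders in s, are unbounded. A relation on the curve has bounded
    exponents only because each order comes from a monomial with exponents at most D. *)
Lemma kappa_coef w n D f (b : nat) : bd (n := n) D f -> (kappa w n f)`_b != 0 ->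
  exists al : nat -> nat, (forall i, (al i <= D)%N) /\ b = (\sum_(i < n) w i * al i)%N.
Proof.
elim: n f b => [|n IH] f b.
  move=> _ /=; rewrite coefC; case: ifP => [/eqP-> _|]; last by rewrite eqxx.
  by exists (fun=> 0%N); rewrite big_ord0.
move=> [sf hf]; rewrite /kappa ievS -/(kappa w n) horner_poly coef_sum => hb.
have [j hj] : exists j : 'I_(size (f : {poly ip n})), (kappa w n f`_j * 'X^(w n) ^+ j)`_b != 0.
  apply: contrapT => /forallNP nj; move/eqP: hb; apply.
  by apply: big1 => j _; apply/eqP/negPn/negP/nj.
move: hj; rewrite -exprM coefMXn; case: ifPn => [|lb]; first by rewrite eqxx.
move=> /(IH _ _ (hf j))[al [aD eb]].
exists (fun i => if i == n then val j else al i); split.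
  by move=> i; case: ifP => // _; rewrite -ltnS; apply: leq_trans (ltn_ord j) sf.
rewrite big_ord_recr/= eqxx -[LHS](subnK (_ : (w n * j <= b)%N)); last by rewrite leqNgt.
by rewrite eb; congr addn; apply: eq_bigr => i _; rewrite ltn_eqF.
Qed.

Lemma order_at0 (p : {poly C}) : p != 0 ->
  exists a q, [/\ p = 'X^a * q, q.[0] != 0 & p`_a != 0].
Proof.
move=> p0; have [a [q]] := multiplicity_XsubC p 0.
rewrite p0 /= polyC0 subr0 /root => q0 pE; exists a, q; split=> //.
  by rewrite mulrC.
by rewrite pE coefMXn ltnn subnn -horner_coef0.
Qed.

Lemma small_nonroot (p : {poly C}) : p != 0 ->
  exists2 s1, 0 < s1 & forall s, 0 < s < s1 -> p.[s%:C%C] != 0.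
Proof.
move=> /order_at0[a [q [pE q0 _]]].
have [H H0 hH] := poly_lipschitz0 q.
have nq0 : 0 < nc q.[0] by rewrite nc_gt0.
exists (Num.min 1 (nc q.[0] / H)); first by rewrite lt_min ltr01 divr_gt0.
move=> s /andP[s0]; rewrite lt_min => /andP[s1]; rewrite ltr_pdivlMr// => sH.
have sn0 : s%:C%C != 0 :> C by rewrite -nc_eq0 ncR ?lt0r_neq0// ltW.
rewrite pE hornerM hornerXn mulf_neq0 ?expf_neq0//.
apply: contraTneq sH => qs0; rewrite -leNgt.
have := hH s%:C%C; rewrite qs0 sub0r ncN ncR ?(ltW s0)// [s * H]mulrC; apply; exact: ltW.
Qed.

Section Invariant.
Variables (z : nat) (z1 : (1 < z)%N) (n D k : nat) (f q : {poly ip n}).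
Hypothesis f0 : f != 0.
Hypothesis fD : bd (n := n.+1) D f.
Hypothesis finv : lead_coef f ^+ k *: (isub z n.+1 f : {poly ip n}) = q * f.

Let beta := (D * z ^ D)%N.
Let expo := {ffun 'I_n.+1 -> 'I_beta.+1}.
Let toN (e : expo) (i : nat) : nat := e (inord i).

(** The relation holding at a curve point is not known in advance, so all binomials with exponents
    at most beta are multiplied; the factor X takes care of y = 0. In beta, D bounds the exponents
    of f and z^D the exponent N of the root-of-unity step. *)
Definition relation_poly : {poly ip n} :=
  'X * \prod_(e1 : expo) \prod_(e2 : expo | e1 != e2) (im n.+1 (toN e1) - im n.+1 (toN e2)).

Definition curve_point (w : nat -> nat) (s y : C) (i : nat) : C :=
  if i == n then y else s ^+ w i.

Lemma ieval_curve_point w s y (g : ip n) : ieval (curve_point w s y) n g = (kappa w n g).[s].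
Proof.
rewrite kappa_horner; apply: ieval_ext => i ni.
by rewrite /curve_point ltn_eqF.
Qed.

Lemma ieval_curve_pointS w s y (g : {poly ip n}) :
  ieval (curve_point w s y) n.+1 g = \sum_(j < size g) (kappa w n g`_j).[s] * y ^+ j.
Proof.
rewrite ievalS horner_poly; apply: eq_bigr => j _.
by rewrite ieval_curve_point /curve_point eqxx.
Qed.

Lemma ieval_relation_poly x : ieval x n.+1 relation_poly = x n *
  \prod_(e1 : expo) \prod_(e2 : expo | e1 != e2)
    (\prod_(i < n.+1) x i ^+ toN e1 i - \prod_(i < n.+1) x i ^+ toN e2 i).
Proof.
rewrite rmorphM; congr (_ * _); first by rewrite ievalS map_polyX hornerX.
rewrite rmorph_prod; apply: eq_bigr => e1 _; rewrite rmorph_prod.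
by apply: eq_bigr => e2 _; rewrite rmorphB !ieval_im.
Qed.

Lemma relation_poly_eval (x : nat -> C) u v :
  (forall i, (i <= n)%N -> (u i <= beta)%N /\ (v i <= beta)%N) ->
  u n != v n -> \prod_(i < n.+1) x i ^+ u i = \prod_(i < n.+1) x i ^+ v i ->
  ieval x n.+1 relation_poly = 0.
Proof.
move=> uvb uvn e; pose ff (u : nat -> nat) : expo := [ffun i : 'I_n.+1 => inord (u i)].
have ffE (w : nat -> nat) i : (forall i, (i <= n)%N -> (w i <= beta)%N) -> (i <= n)%N ->
    toN (ff w) i = w i.
  by move=> wb ni; rewrite /toN ffunE inordK ?inordK// ltnS wb.
have uE i : (i <= n)%N -> toN (ff u) i = u i by apply: ffE => j /uvb[].
have vE i : (i <= n)%N -> toN (ff v) i = v i by apply: ffE => j /uvb[].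
have ne : ff u != ff v.
  by apply: contra_neq uvn => e'; rewrite -uE// -vE// e'.
rewrite ieval_relation_poly (bigD1 (ff u))//= (bigD1 (ff v))//=.
rewrite (eq_bigr (fun i : 'I_n.+1 => x i ^+ u i)); last by move=> i _; rewrite uE// -ltnS.
rewrite [X in _ - X](eq_bigr (fun i : 'I_n.+1 => x i ^+ v i)); last first.
  by move=> i _; rewrite vE// -ltnS.
by rewrite e subrr mul0r mul0r mulr0.
Qed.

Lemma relation_poly_root (x : nat -> C) : x n != 0 -> ieval x n.+1 relation_poly = 0 ->
  exists u v : nat -> nat, [/\ forall i, (i <= n)%N -> (u i <= beta)%N /\ (v i <= beta)%N,
    exists2 i, (i <= n)%N & u i != v i &
    \prod_(i < n.+1) x i ^+ u i = \prod_(i < n.+1) x i ^+ v i].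
Proof.
move=> xn0 /eqP; rewrite ieval_relation_poly mulf_eq0 (negbTE xn0) /=.
move=> /prodf_eq0[e1 _] /prodf_eq0[e2 ne]; rewrite subr_eq0 => /eqP e.
exists (toN e1), (toN e2); split=> //.
  by move=> i _; split; exact: leq_ord.
have : [exists i, e1 i != e2 i].
  apply: contraR ne => /existsPn h; apply/eqP/ffunP => i; apply/eqP.
  by have := h i; rewrite negbK.
move=> /existsP[i hi]; exists i; first by rewrite -ltnS.
by rewrite /toN inord_val.
Qed.

Lemma relation_poly_on_curve w : kappa w n (lead_coef f) != 0 ->
  exists2 s0, 0 < s0 & forall s y, 0 < s < s0 ->
  ieval (curve_point w s%:C%C y) n.+1 f = 0 ->
  ieval (curve_point w s%:C%C y) n.+1 relation_poly = 0.
Proof.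
move=> hlc.
have [s1 s10 hs1] := small_nonroot hlc.
pose m := size f.
have ex_ord (j : 'I_m) : exists aq : nat * {poly C}, kappa w n f`_j != 0 ->
    [/\ kappa w n f`_j = 'X^(aq.1) * aq.2, aq.2.[0] != 0 & (kappa w n f`_j)`_(aq.1) != 0].
  have [->|] := eqVneq (kappa w n f`_j) 0; first by exists (0%N, 0).
  by move=> /order_at0[a [r h]]; exists (a, r).
have [aq haq] := choice ex_ord.
pose a j := (aq j).1; pose kk j := (aq j).2.
pose P (j : 'I_m) := kappa w n f`_j != 0.
have m0 : (0 < m)%N by rewrite size_poly_gt0.
have Pn0 : exists j, P j.
  have lt : (m.-1 < m)%N by rewrite ltn_predL.
  by exists (Ordinal lt); rewrite /P /= -lead_coefE.
have k0 j : P j -> (kk j).[0] != 0 by move=> /haq[].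
have [s0 s00 hs0] := power_invariant_curve a z1 k0 Pn0.
have curveE (s : R) y : curve P a kk s y = ieval (curve_point w s%:C%C y) n.+1 f.
  rewrite ieval_curve_pointS /curve [LHS]big_mkcond; apply: eq_bigr => j _.
  case: ifPn => [Pj|]; last by rewrite negbK => /eqP->; rewrite horner0 mul0r.
  by have [-> _ _] := haq j Pj; rewrite hornerM hornerXn [_ * (kk j).[_]]mulrC mulrA.
(* Evaluate [finv] at the point: the right side vanishes and the leading coefficient does not, so f
   vanishes at the image under the power map. *)
have inv (s : R) y : 0 < s < Num.min 1 s1 -> ieval (curve_point w s%:C%C y) n.+1 f = 0 ->
    ieval (curve_point w (s ^+ z)%:C%C (y ^+ z)) n.+1 f = 0.
  move=> /andP[sp]; rewrite lt_min => /andP[slt1 slt] e.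
  have := congr1 (ieval (curve_point w s%:C%C y) n.+1) finv.
  rewrite [RHS]rmorphM [X in _ * X]e mulr0 -mul_polyC [LHS]rmorphM => /eqP.
  have le : ieval (curve_point w s%:C%C y) n (lead_coef f) != 0.
    by rewrite ieval_curve_point hs1// sp.
  rewrite mulf_eq0 ieval_polyC [ieval _ _ (_ ^+ _)]rmorphXn expf_eq0 (negbTE le) andbF orFb => /eqP.
  rewrite ieval_isub => <-; apply: ieval_ext => i _; rewrite /curve_point.
  by case: ifP => // _; rewrite rmorphXn exprAC.
exists (Num.min s0 (Num.min 1 s1)); first by rewrite !lt_min s00 ltr01.
move=> s y /andP[sp]; rewrite lt_min => /andP[slt0 slt1] e.
have [y0|y0] := eqVneq y 0.
  by rewrite ieval_relation_poly {1}/curve_point eqxx y0 mul0r.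
have hc t : curve P a kk (s ^+ (z ^ t)) (y ^+ (z ^ t)) = 0.
  rewrite curveE; elim: t => [|t IH]; first by rewrite expn0 !expr1.
  rewrite expnSr !exprM; apply: inv => //; rewrite exprn_gt0//=.
  apply: le_lt_trans (slt1); rewrite -[X in _ <= X]expr1 ler_wiXn2l ?(ltW sp)//.
    by move: slt1; rewrite lt_min => /andP[/ltW].
  by rewrite expn_gt0 (ltnW z1).
have [|j1 [j2 [N [Pj1 Pj2 j12 /andP[N0 NB] ej]]]] := hs0 s y _ y0 hc.
  by rewrite sp.
have [sf hf] := fD.
have [_ _ c1] := haq j1 Pj1; have [_ _ c2] := haq j2 Pj2.
have [al1 [b1 e1]] := kappa_coef (hf j1) c1.
have [al2 [b2 e2]] := kappa_coef (hf j2) c2.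
have zN : (N <= z ^ D)%N.
  by apply: leq_trans NB _; rewrite leq_exp2l// -ltnS prednK.
have jD (j : 'I_m) : (j <= D)%N by rewrite -ltnS; apply: leq_trans (ltn_ord j) sf.
pose u i := ((if i == n then val j1 else al1 i) * N)%N.
pose v i := ((if i == n then val j2 else al2 i) * N)%N.
have prodE (al : nat -> nat) (j : 'I_m) :
    \prod_(i < n.+1) curve_point w s%:C%C y i ^+ ((if i == n :> nat then val j else al i) * N) =
    (s%:C%C ^+ (\sum_(i < n) w i * al i) * y ^+ j) ^+ N.
  rewrite big_ord_recr/= /curve_point eqxx exprM exprMn; congr (_ * _).
  rewrite expr_sum -prodrXl; apply: eq_bigr => i _.
  by rewrite ltn_eqF// -!exprM mulnA.
apply: (@relation_poly_eval _ u v).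
- move=> i _; rewrite /u /v /beta; split; apply: leq_mul => //; by case: ifP; rewrite ?jD ?b1 ?b2.
- by rewrite /u /v eqxx eqn_pmul2r// neq_ltn j12.
- by rewrite !prodE -e1 -e2.
Qed.

(** The power [size f] absorbs multiple roots. A nonzero pseudo-remainder would keep its size at a
    small generic curve parameter, where the specialized f divides it although it is smaller. *)
Lemma relation_poly_dvd : exists k' (q' : {poly ip n}),
  lead_coef f ^+ k' *: relation_poly ^+ size f = q' * f.
Proof.
have [//|//|//|//|k' [q' [r [e sr _]]]] := @pseudo_division (ip n) (fun _ _ => True) _ _ _ _ f 0 f0
  (fun=> I) _ (relation_poly ^+ size f) 0 (leqnn _) (fun=> I).
exists k', q'; rewrite e; suff -> : r = 0 by rewrite addr0.
apply: contrapT => /eqP r0.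
have [|w] := @kappa_neq0 n (lead_coef f * lead_coef r).
  by rewrite mulf_neq0 ?lead_coef_eq0.
rewrite rmorphM mulf_eq0 negb_or => /andP[hf hr].
have [s0 s00 hs0] := relation_poly_on_curve hf.
have [s1 s10 hs1] := small_nonroot hf.
have [s2 s20 hs2] := small_nonroot hr.
have [s sp [lt0 lt1 lt2]] : exists2 s : R, 0 < s & [/\ s < s0, s < s1 & s < s2].
  exists (Num.min s0 (Num.min s1 s2) / 2); first by rewrite divr_gt0// !lt_min s00 s10.
  have lt : Num.min s0 (Num.min s1 s2) / 2 < Num.min s0 (Num.min s1 s2).
    by rewrite gtr_pMr ?invf_lt1// ?ltr1n// !lt_min s00 s10.
  by split; apply: (lt_le_trans lt); rewrite !ge_min lexx ?orbT.
(* Only the first n coordinates are read, so 0 is a dummy value for y. *)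
pose ev := ieval (curve_point w s%:C%C 0) n : {rmorphism ip n -> C}.
have evE y (g : {poly ip n}) : ieval (curve_point w s%:C%C y) n.+1 g = (map_poly ev g).[y].
  rewrite ievalS {2}/curve_point eqxx; congr (_.[_]); apply: eq_map_poly => b.
  by rewrite /ev !ieval_curve_point.
have lf : ev (lead_coef f) != 0 by rewrite /ev ieval_curve_point hs1// sp.
have lr : ev (lead_coef r) != 0 by rewrite /ev ieval_curve_point hs2// sp.
have sfs : size (map_poly ev f) = size f by rewrite size_poly_eq.
have srs : size (map_poly ev r) = size r by rewrite size_poly_eq.
set fs := map_poly ev f in sfs *.
have dv : fs %| map_poly ev relation_poly ^+ size f.
  have [rs ers] := closed_field_poly_normal fs.
  have fs0 : fs != 0 by rewrite -size_poly_eq0 sfs size_poly_eq0.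
  have srs' : (size rs < size f)%N.
    by rewrite -sfs [X in size (polyseq X)]ers size_scale ?lead_coef_eq0// size_prod_XsubC.
  have rt y : y \in rs -> ('X - y%:P) %| map_poly ev relation_poly.
    move=> yr; rewrite dvdp_XsubCl /root -evE hs0 ?sp//.
    by rewrite evE -/fs ers hornerZ (rootP (_ : root _ y)) ?mulr0// root_prod_XsubC.
  rewrite ers dvdpZl ?lead_coef_eq0//.
  apply: (@dvdp_trans _ (map_poly ev relation_poly ^+ size rs)).
    elim: rs rt {ers srs'} => [|y rs IH] rt; first by rewrite big_nil expr0.
    rewrite big_cons exprS dvdp_mul ?rt ?mem_head// IH// => y' hy'.
    by apply: rt; rewrite in_cons hy' orbT.
  by rewrite dvdp_exp2l// ltnW.
have := congr1 (map_poly ev) e.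
rewrite rmorphD rmorphM /= map_polyZ [map_poly ev (_ ^+ _)]rmorphXn -/fs => es.
have : fs %| map_poly ev r.
  have -> : map_poly ev r = ev (lead_coef f ^+ k') *: map_poly ev relation_poly ^+ size f -
      map_poly ev q' * fs by rewrite es addrC addKr.
  by rewrite dvdp_sub ?dvdp_mull// dvdpZr// rmorphXn expf_neq0.
move/dvdp_leq; rewrite -size_poly_eq0 srs size_poly_eq0 r0 sfs => /(_ isT).
by rewrite leqNgt sr.
Qed.

Lemma invariant_relation (x : nat -> C) :
  x n != 0 -> ieval x n.+1 f = 0 -> ieval x n (lead_coef f) != 0 ->
  exists u v : nat -> nat, [/\ forall i, (i <= n)%N -> (u i <= D * z ^ D)%N /\ (v i <= D * z ^ D)%N,
    exists2 i, (i <= n)%N & u i != v i &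
    \prod_(i < n.+1) x i ^+ u i = \prod_(i < n.+1) x i ^+ v i].
Proof.
move=> xn0 fx lx; apply: relation_poly_root => //.
have [k' [q' /(congr1 (ieval x n.+1))]] := relation_poly_dvd.
rewrite [RHS]rmorphM [X in _ * X]fx mulr0 -mul_polyC [LHS]rmorphM => /eqP.
rewrite mulf_eq0 ieval_polyC !rmorphXn !expf_eq0 (negbTE lx) andbF orFb.
by move=> /andP[_ /eqP].
Qed.
End Invariant.
End IteratedPoly.

(** * Bounded multiplicative relations on orbits *)

(* Degree of the pseudo-remainder of f(X^z) by f, for f of partial degrees <= D. *)
Definition rem_degree (z D : nat) : nat := (z * D + (z * D).+1 * D)%N.
(** Every nonzero remainder has smaller degree in the last variable, so D remainder steps
    suffice. *)
Definition elim_degree (z D : nat) : nat := iter D (rem_degree z) D.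
(** W is the degree bound after eliminating all n variables; the power of z combines the order of
    the root of unity with the time at which the relation is found. *)
Definition relation_bound (z n d : nat) : nat :=
  let W := iter n (elim_degree z) d in (W * z ^ (W + n * W))%N.

Lemma leq_iter (h : nat -> nat) e D : (forall D, D <= h D)%N -> (D <= iter e h D)%N.
Proof. by move=> hh; elim: e => //= e IH; apply: leq_trans IH (hh _). Qed.

Lemma relation_bound_computable : computable3 relation_bound.
Proof.
have hrem : recursive 2 (fun v => rem_degree (nth 0 v 1) (nth 0 v 0))%N.
  have h : recursive 2 (fun v => nth 0 v 1 * nth 0 v 0)%N.
    by apply: recursive_mul; apply: recursive_var.
  by apply: recursive_add => //; apply: recursive_mul; [apply: recursive_succ|apply: recursive_var].
have helim : recursive 2 (fun v => elim_degree (nth 0 v 1) (nth 0 v 0))%N.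
  apply: (@recursive_iter 2 (fun D v => rem_degree (nth 0 v 1) D)%N); try exact: recursive_var.
  have := recursive_op2 (op := fun D z => rem_degree z D) hrem
    (@recursive_var 3 0 isT) (@recursive_var 3 2 isT).
  by apply: recursive_ext => v; case/tupleP: v => a v; case/tupleP: v => b v; case/tupleP: v => c v.
have hW : recursive 3 (fun v => iter (nth 0 v 1) (elim_degree (nth 0 v 0)) (nth 0 v 2))%N.
  apply: (@recursive_iter 3 (fun D v => elim_degree (nth 0 v 0) D)%N); try exact: recursive_var.
  have := recursive_op2 (op := fun D z => elim_degree z D) helim
    (@recursive_var 4 0 isT) (@recursive_var 4 1 isT).
  by apply: recursive_ext => v; case/tupleP: v => a v; case/tupleP: v => b v.
have [f hf] : recursive 3 (fun v => relation_bound (nth 0 v 0) (nth 0 v 1) (nth 0 v 2))%N.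
  apply: recursive_mul => //; apply: recursive_exp; first exact: recursive_var.
  by apply: recursive_add => //; apply: recursive_mul => //; apply: recursive_var.
by exists f => a b c; apply: (hf [tuple a; b; c]).
Qed.

Section Relation.
Variables (R : realType) (z : nat).
Hypothesis z1 : (1 < z)%N.
Local Notation C := R[i].

Definition bounded_relation (n B : nat) (x : nat -> C) : Prop :=
  exists u v : nat -> nat, [/\ forall i, (i < n)%N -> (u i <= B)%N /\ (v i <= B)%N,
    exists2 i, (i < n)%N & u i != v i &
    \prod_(i < n) x i ^+ u i = \prod_(i < n) x i ^+ v i].

Definition powx (x : nat -> C) t i := x i ^+ (z ^ t).

Lemma bounded_relation_le n B B' x : (B <= B')%N ->
  bounded_relation n B x -> bounded_relation n B' x.
Proof.
move=> BB [u [v [h1 h2 h3]]]; exists u, v; split=> // i /h1[hu hv].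
by split; [apply: leq_trans hu BB|apply: leq_trans hv BB].
Qed.

Lemma bounded_relationS n B x : bounded_relation n B x -> bounded_relation n.+1 B x.
Proof.
move=> [u [v [h1 [i ni h2] h3]]].
exists (fun i => if (i < n)%N then u i else 0%N), (fun i => if (i < n)%N then v i else 0%N).
split=> [j _||]; first by case: ifP => // /h1.
  by exists i; [apply: leqW|rewrite ni].
rewrite !big_ord_recr/= !ltnn !expr0 !mulr1.
rewrite (eq_bigr (fun i : 'I_n => x i ^+ u i)); last by move=> j _; rewrite ltn_ord.
by rewrite h3; apply: eq_bigr => j _; rewrite ltn_ord.
Qed.

Lemma bounded_relation_powx n B x t :
  bounded_relation n B (powx x t) -> bounded_relation n (B * z ^ t) x.
Proof.
move=> [u [v [h1 [i ni h2] h3]]].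
exists (fun i => u i * z ^ t)%N, (fun i => v i * z ^ t)%N; split.
- by move=> j /h1[hu hv]; rewrite !leq_mul2r hu hv !orbT.
- by exists i => //; rewrite eqn_pmul2r// expn_gt0 (ltnW z1).
- have e (w : nat -> nat) : \prod_(i < n) x i ^+ (w i * z ^ t) = \prod_(i < n) powx x t i ^+ w i.
    by apply: eq_bigr => j _; rewrite /powx -exprM mulnC.
  by rewrite !e.
Qed.

Lemma rem_degree_ge D : (D <= rem_degree z D)%N.
Proof. by rewrite /rem_degree; apply: leq_trans (leq_addr _ _); rewrite leq_pmull// ltnW. Qed.

Lemma elim_degree_ge D : (D <= elim_degree z D)%N.
Proof. by apply: leq_iter; apply: rem_degree_ge. Qed.

Lemma ieval_powxS x t n (f : ip R n) :
  ieval (powx x t) n (isub R z n f) = ieval (powx x t.+1) n f.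
Proof.
rewrite ieval_isub; apply: ieval_ext => i _.
by rewrite /powx -exprM expnSr.
Qed.

Lemma isub_remainder n D (f : {poly ip R n}) : f != 0 -> bd (n := n.+1) D f ->
  exists k (q r : {poly ip R n}),
  [/\ lead_coef f ^+ k *: (isub R z n.+1 f : {poly ip R n}) = q * f + r,
      (size r < size f)%N & bd (n := n.+1) (rem_degree z D) r].
Proof.
move=> f0 fD; have [sf hf] := fD.
have [sg hg] := bd_isub (ltnW z1) fD.
have [k [q [r [e sr rB]]]] := @pseudo_division (ip R n) (fun D => @bd R n D)
  (fun D D' a => @bd_mono R n D D' a) (fun D a b ha hb => bd_add ha (bd_opp hb))
  (fun D D' a b => @bd_mul R n D D' a b) (@bd0 R n) f D f0 hf (z * D).+1
  (isub R z n.+1 f) (z * D)%N sg hg.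
exists k, q, r; split=> //; split=> //.
by apply: ltnW; apply: (leq_trans sr); apply: (leq_trans sf); rewrite ltnS rem_degree_ge.
Qed.

(** Eliminate the last variable by remainders until the equation is free of it, its leading
    coefficient takes over, or it is invariant and gives a relation. With no variable left, a
    nonzero constant would vanish. *)
Lemma orbit_relation W n D (f : ip R n) x : (forall i, (i < n)%N -> x i != 0) ->
  f != 0 -> bd D f -> (iter n (elim_degree z) D <= W)%N ->
  (forall t, (t <= n * W)%N -> ieval (powx x t) n f = 0) ->
  bounded_relation n (W * z ^ (W + n * W)) x.
Proof.
elim: n D f => [|n IH] D f x0 f0 fD DW hx.
  have := hx 0%N (leq0n _); rewrite -[LHS]/(f : C) => e.
  by rewrite e eqxx in f0.
rewrite iterSr in DW; set D' := elim_degree z D in DW.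
have D'W : (D' <= W)%N.
  by apply: leq_trans DW; apply: leq_iter; apply: elim_degree_ge.
have DD' : (D <= D')%N by apply: elim_degree_ge.
have x0' i : (i < n)%N -> x i != 0 by move=> ni; apply: x0; apply: leqW.
have BB : (W * z ^ (W + n * W) <= W * z ^ (W + n.+1 * W))%N.
  by rewrite leq_mul2l leq_exp2l// leq_add2l leq_mul2r leqnSn !orbT.
have IH' (c : ip R n) : c != 0 -> bd D' c ->
    (forall t, (t <= n * W)%N -> ieval (powx x t) n c = 0) ->
    bounded_relation n.+1 (W * z ^ (W + n.+1 * W)) x.
  move=> c0 cD hc; apply: bounded_relation_le BB _; apply: bounded_relationS.
  exact: IH c0 cD DW hc.
(* Here e bounds both the degree in the last variable and the remainder steps still to come. It
   starts at D <= W, so the times needed stay within (n + 1) W. *)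
suff Q e : forall D0 (g : {poly ip R n}), g != 0 -> (size g <= e.+1)%N ->
    bd (n := n.+1) D0 g -> (iter e (rem_degree z) D0 <= D')%N ->
    (forall t, (t <= e + n * W)%N -> ieval (powx x t) n.+1 g = 0) ->
    bounded_relation n.+1 (W * z ^ (W + n.+1 * W)) x.
  have [sf hf] := fD; apply: (Q D D f) => // t ht; apply: hx.
  by apply: leq_trans ht _; rewrite mulSn leq_add2r; apply: leq_trans D'W.
elim: e => [|e IHe] D0 g g0 sg gD gD' hg.
  have gE := size1_polyC sg.
  have [_ hgc] := gD.
  apply: (IH' g`_0).
  - by rewrite -polyC_eq0 -gE.
  - exact: bd_mono gD' (hgc 0%N).
  - by move=> t ht; rewrite -ieval_polyC -gE hg.
rewrite iterSr in gD'.
have [sg'|sg'] := leqP (size g) e.+1.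
  apply: (IHe (rem_degree z D0) g) => //; first exact: bd_mono (rem_degree_ge _) gD.
  by move=> t ht; apply: hg; apply: (leq_trans ht); rewrite leq_add2r.
have [k [q [r [er sr rB]]]] := isub_remainder g0 gD.
(* A remainder vanishes at time t if g does at t and t + 1, so each one costs one unit of time. *)
have [r0|r0] := eqVneq r 0; last first.
  apply: (IHe _ r r0 _ rB gD').
    by rewrite -ltnS; apply: leq_trans sr sg.
  move=> t ht.
  have -> : r = lead_coef g ^+ k *: (isub R z n.+1 g : {poly ip R n}) - q * g.
    by rewrite er addrC addKr.
  rewrite [LHS]rmorphB -mul_polyC ![ieval _ _ (_ * _)]rmorphM ieval_powxS.
  have -> : ieval (powx x t.+1) n.+1 g = 0 by apply: hg; rewrite addSn ltnS.
  have -> : ieval (powx x t) n.+1 g = 0.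
    by apply: hg; apply: (leq_trans ht); rewrite leq_add2r.
  by rewrite !mulr0 subr0.
rewrite r0 addr0 in er.
have D0D' : (D0 <= D')%N.
  apply: leq_trans gD'; apply: leq_trans (rem_degree_ge D0) _.
  by apply: leq_iter; apply: rem_degree_ge.
have D0W := leq_trans D0D' D'W.
(* If the leading coefficient is nonzero at some such orbit point, the relation there pulls back to
   x with exponents multiplied by z^t. Otherwise that coefficient is an equation in one variable
   less. *)
have [[t ht lt]|nex] := pselect (exists2 t, (t <= n * W)%N &
    ieval (powx x t) n (lead_coef g) != 0).
  have px0 : powx x t n != 0 by rewrite expf_neq0// x0.
  have gt0 : ieval (powx x t) n.+1 g = 0.
    by apply: hg; apply: (leq_trans ht); rewrite leq_addl.
  have rel : bounded_relation n.+1 (D0 * z ^ D0) (powx x t).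
    exact: (invariant_relation z1 g0 gD er px0 gt0 lt).
  apply: bounded_relation_le (bounded_relation_powx rel).
  rewrite -mulnA -expnD; apply: leq_mul => //; rewrite leq_exp2l//.
  by rewrite leq_add//; apply: (leq_trans ht); rewrite leq_mul2r leqnSn orbT.
apply: (IH' (lead_coef g)); first by rewrite lead_coef_eq0.
  by have [_ hgc] := gD; apply: bd_mono D0D' (hgc _).
move=> t ht; apply/eqP; apply: contraT => lt; case: nex; by exists t.
Qed.
End Relation.

Section MpolyToIp.
Variable R : realType.
Local Notation C := R[i].

Lemma ip_const n (c : C) : exists g : ip R n, (forall D, bd D g) /\ forall x, ieval x n g = c.
Proof.
elim: n => [|n [g [gD gx]]]; first by exists c.
exists (g%:P : {poly ip R n}); split=> [D|x]; last by rewrite ieval_polyC.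
split; first by rewrite (leq_trans (size_polyC_leq1 _)).
by move=> j; rewrite coefC; case: ifP => _ //; apply: bd0.
Qed.

Lemma bd_im n D (u : nat -> nat) : (forall i, (i < n)%N -> (u i <= D)%N) -> bd D (im R n u).
Proof.
elim: n => //= n IH hu.
have cE j : ((im R n u)%:P * 'X^(u n))`_j = if (j == u n) then im R n u else 0.
  rewrite coefMXn coefC; case: ltngtP => // [lt|->]; last by rewrite subnn.
  by rewrite subn_eq0 leqNgt lt.
split=> [|j]; last first.
  by rewrite cE; case: ifP => _; [apply: IH => i ni; apply: hu; apply: leqW|apply: bd0].
apply/leq_sizeP => j hj; rewrite cE gtn_eqF//.
by apply: leq_trans hj; rewrite ltnS hu.
Qed.

Lemma mpoly_to_ip n d (f : {mpoly C[n]}) : (msize f <= d.+1)%N ->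
  exists g : ip R n, bd d g /\
    forall x : nat -> C, ieval x n g = f.@[fun i : 'I_n => x i].
Proof.
move=> fd.
have term m : m \in msupp f -> exists g : ip R n, bd d g /\
    forall x : nat -> C, ieval x n g = f@_m * \prod_(i < n) x i ^+ m i.
  move=> mf; have [c [cD cx]] := ip_const n f@_m.
  exists (c * im R n (fun i => nth 0%N m i)); split.
    rewrite -[d]add0n; apply: bd_mul => //; apply: bd_im => i ni.
    have := leq_trans (msize_mdeg_lt mf) fd; rewrite ltnS; apply: leq_trans.
    by rewrite mdegE (bigD1 (Ordinal ni))//= (mnm_nth 0%N) leq_addr.
  move=> x; rewrite rmorphM cx ieval_im; congr (_ * _).
  by apply: eq_bigr => i _; rewrite (mnm_nth 0%N).
suff [g [gd gx]] : exists g : ip R n, bd d g /\ forall x : nat -> C,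
    ieval x n g = \sum_(m <- msupp f) f@_m * \prod_(i < n) x i ^+ m i.
  by exists g; split=> // x; rewrite gx mevalE.
elim: (msupp f) term => [|m l IH] term.
  by exists 0; split=> [|x]; [apply: bd0|rewrite rmorph0 big_nil].
have [g1 [gd1 gx1]] := term m (mem_head _ _).
have [g2 [gd2 gx2]] : exists g : ip R n, bd d g /\ forall x : nat -> C,
    ieval x n g = \sum_(m <- l) f@_m * \prod_(i < n) x i ^+ m i.
  by apply: IH => m' m'l; apply: term; rewrite in_cons m'l orbT.
exists (g1 + g2); split=> [|x]; first exact: bd_add.
by rewrite rmorphD gx1 gx2 big_cons.
Qed.

Lemma mpoly_orbit_relation z n d (f : {mpoly C[n]}) (x x0 : 'I_n -> C) : (1 < z)%N ->
  (msize f <= d.+1)%N -> f.@[x0] != 0 -> Gm x ->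
  (forall t, f.@[power_map (z ^ t) x] = 0) ->
  exists u v : 'I_n -> nat,
    [/\ forall i, (u i <= relation_bound z n d)%N /\ (v i <= relation_bound z n d)%N,
        exists i, u i != v i & \prod_(i < n) x i ^+ u i = \prod_(i < n) x i ^+ v i].
Proof.
move=> z1 fd fx0 xG hx; have [g [gd gx]] := mpoly_to_ip fd.
pose ext (y : 'I_n -> C) (j : nat) : C := if insub j is Some i then y i else 1.
have extE y (i : 'I_n) : ext y i = y i by rewrite /ext valK.
have g0 : g != 0.
  apply: contra_neq fx0 => g0; have := gx (ext x0); rewrite g0 rmorph0 => e.
  by rewrite [RHS]e; apply: meval_eq => i; rewrite extE.
have [||u [v [h1 [i ni h2] h3]]] := @orbit_relation R z z1 _ n d g (ext x) _ g0 gd (leqnn _).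
- by move=> j nj; rewrite (extE x (Ordinal nj)).
- move=> t _; rewrite gx -[RHS](hx t); apply: meval_eq => i.
  by rewrite /powx extE.
exists (fun i => u i), (fun i => v i); split.
- by move=> j; apply: h1.
- by exists (Ordinal ni).
- by have e (w : nat -> nat) : \prod_(i < n) x i ^+ w i = \prod_(i < n) ext x i ^+ w i;
    [apply: eq_bigr => j _; rewrite extE | rewrite !e].
Qed.
End MpolyToIp.

(** * Torsion cosets of codimension one *)

Section IntExponents.
Variable F : fieldType.
Implicit Types (x y : F) (b : int).

Definition posz b : nat := if b is Posz m then m else 0%N.
Definition negz b : nat := if b is Negz m then m.+1 else 0%N.

Lemma expz_pos_neg x b : x ^ b = x ^+ posz b / x ^+ negz b.
Proof. by case: b => m; rewrite /= expr0 ?divr1 ?div1r. Qed.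

Lemma posz_negz_eq b : posz b = negz b -> b = 0.
Proof. by case: b => [m|m] //= ->. Qed.

Lemma prod_expz n x (b : 'I_n -> int) : x != 0 -> \prod_i x ^ b i = x ^ (\sum_i b i).
Proof.
by move=> x0; elim/big_ind2: _ => // y s z t -> ->; rewrite expfzDr.
Qed.

Lemma expz_prod n (x : 'I_n -> F) b : (\prod_i x i) ^ b = \prod_i x i ^ b.
Proof.
elim/big_ind2: _ => // [|y s z t <- <-]; first by rewrite exp1rz.
by rewrite expfzMl.
Qed.

Lemma unity_expz x m b : x ^+ m = 1 -> (x ^ b) ^+ m = 1.
Proof. by move=> e; rewrite exprnP exprz_exp mulrC -exprz_exp -exprnP e exp1rz. Qed.
End IntExponents.

Section TorsionCoset.
Variables (R : realType) (n : nat).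
Local Notation C := R[i].
Implicit Types (x w : 'I_n -> C) (a : 'I_n -> int).

Definition lmon x a : C := \prod_i x i ^ a i.
Definition mpos a : 'X_{1..n} := [multinom posz (a i) | i < n].
Definition mneg a : 'X_{1..n} := [multinom negz (a i) | i < n].
Definition binomial_poly a (zeta : C) : {mpoly C[n]} :=
  'X_[mpos a] - zeta *: 'X_[mneg a].
Definition tcoset a (zeta : C) : set ('I_n -> C) := [set x | Gm x /\ lmon x a = zeta].

Lemma lmon_mul x w a : lmon (ptmul x w) a = lmon x a * lmon w a.
Proof. by rewrite -big_split; apply: eq_bigr => i _; rewrite expfzMl. Qed.

Lemma lmon_inv x a : lmon (ptinv x) a = (lmon x a)^-1.
Proof.
by rewrite -prodfV; apply: eq_bigr => i _; rewrite exprz_inv invr_expz.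
Qed.

Lemma lmon_neq0 x a : Gm x -> lmon x a != 0.
Proof. by move=> x0; apply/prodf_neq0 => i _; rewrite expfz_neq0. Qed.

Lemma lmon_div x a : lmon x a = 'X_[mpos a].@[x] / 'X_[mneg a].@[x].
Proof.
rewrite !mevalX -prodf_div; apply: eq_bigr => i _.
by rewrite !mnmE expz_pos_neg.
Qed.

Lemma mevalX_neq0 x m : Gm x -> ('X_[m] : {mpoly C[n]}).@[x] != 0.
Proof. by move=> x0; rewrite mevalX; apply/prodf_neq0 => i _; rewrite expf_neq0. Qed.

Lemma binomial_poly_eq0 x a zeta : Gm x ->
  ((binomial_poly a zeta).@[x] == 0) = (lmon x a == zeta).
Proof.
move=> x0; rewrite mevalB mevalZ subr_eq0 lmon_div.
have m0 := mevalX_neq0 (mneg a) x0.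
by rewrite -[X in _ = (_ == X)](mulfK m0) (inj_eq (mulIf _)) ?invr_eq0.
Qed.

Lemma tcoset_subvariety a zeta : subvariety (tcoset a zeta).
Proof.
exists [set binomial_poly a zeta]; apply/seteqP; split=> x [x0].
  by move=> e; split=> // _ ->; apply/eqP; rewrite binomial_poly_eq0// e.
by move=> /(_ _ erefl)/eqP; rewrite binomial_poly_eq0// => /eqP.
Qed.

Lemma X_neq0 m : ('X_[m] : {mpoly C[n]}) != 0.
Proof. by rewrite -mleadc_eq0 mleadXm mcoeffX eqxx oner_eq0. Qed.

Lemma tofrac_X m : tofrac ('X_[m] : {mpoly C[n]}) = \prod_i tofrac 'X_i ^+ m i.
Proof. by rewrite mpolyXE_id rmorph_prod; apply: eq_bigr => i _; rewrite rmorphXn. Qed.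

Lemma lmonomialE a : lmonomial R a = tofrac 'X_[mpos a] / tofrac 'X_[mneg a].
Proof.
rewrite !tofrac_X -prodf_div; apply: eq_bigr => i _.
by rewrite !mnmE expz_pos_neg.
Qed.

Lemma laurent_binomialE a zeta :
  lmonomial R a - lconst n zeta = tofrac (binomial_poly a zeta) / tofrac 'X_[mneg a].
Proof.
have m0 : tofrac ('X_[mneg a] : {mpoly C[n]}) != 0 by rewrite tofrac_eq0 X_neq0.
rewrite lmonomialE /binomial_poly rmorphB mulrBl; congr (_ - _).
by rewrite -mul_mpolyC rmorphM mulfK.
Qed.

Lemma laurent_zeros_binomial a zeta :
  laurent_zeros (lmonomial R a - lconst n zeta) = tcoset a zeta.
Proof.
have m0 m : tofrac ('X_[m] : {mpoly C[n]}) != 0 by rewrite tofrac_eq0 X_neq0.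
apply/seteqP; split=> x [x0 hx]; split=> //.
  move: hx => [p [m [+ px]]]; rewrite /is_laurent laurent_binomialE => /eqP.
  rewrite eqr_div// -!rmorphM/= tofrac_eq => /eqP/(congr1 (meval x)).
  rewrite !mevalM px mul0r => /eqP; rewrite mulf_eq0 (negbTE (mevalX_neq0 _ x0)) orbF.
  by rewrite binomial_poly_eq0// => /eqP.
exists (binomial_poly a zeta), (mneg a); split; first exact: laurent_binomialE.
by apply/eqP; rewrite binomial_poly_eq0// hx.
Qed.

Lemma binomial_poly_neq0 a zeta : (exists i, a i != 0) -> binomial_poly a zeta != 0.
Proof.
move=> [i ai]; apply/eqP => /(congr1 (mcoeff (mpos a))).
rewrite mcoeffB mcoeffZ !mcoeffX eqxx mcoeff0.
have -> : (mneg a == mpos a) = false.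
  apply/eqP => /mnmP/(_ i); rewrite !mnmE => e.
  by rewrite (posz_negz_eq (esym e)) eqxx in ai.
by rewrite mulr0 subr0 => /eqP; rewrite oner_eq0.
Qed.

Lemma laurent_sim_refl a zeta : (exists i, a i != 0) ->
  laurent_sim (lmonomial R a - lconst n zeta) (lmonomial R a - lconst n zeta).
Proof.
move=> a0; have h0 : lmonomial R a - lconst n zeta != 0.
  rewrite laurent_binomialE mulf_neq0 ?invr_eq0 ?tofrac_eq0 ?X_neq0//.
  exact: binomial_poly_neq0.
split=> //; exists 1, (fun=> 0); rewrite divff// /lconst rmorph1 mul1r.
by rewrite /lmonomial big1.
Qed.

Lemma tcoset_subgroup a : algebraic_subgroup (tcoset a 1).
Proof.
split; first exact: tcoset_subvariety.
- split=> [i|]; first exact: oner_neq0.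
  by rewrite /lmon big1// => i _; rewrite exp1rz.
- move=> x w [x0 hx] [w0 hw]; split; last by rewrite lmon_mul hx hw mulr1.
  by move=> i; rewrite mulf_neq0.
- move=> x [x0 hx]; split; last by rewrite lmon_inv hx invr1.
  by move=> i; rewrite invr_eq0.
Qed.

Lemma tcoset_translate a zeta w : Gm w -> lmon w a = zeta ->
  tcoset a zeta = ptmul w @` tcoset a 1.
Proof.
move=> w0 hw; have z0 : zeta != 0 by rewrite -hw lmon_neq0.
apply/seteqP; split=> [x [x0 hx]|_ [x [x0 hx] <-]]; last first.
  by split=> [i|]; rewrite ?mulf_neq0// lmon_mul hx hw mulr1.
exists (ptmul (ptinv w) x).
  split=> [i|]; first by rewrite mulf_neq0// invr_eq0.
  by rewrite lmon_mul lmon_inv hw hx mulVf.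
by apply/funext => i; rewrite /ptmul /ptinv mulrA mulfV// mul1r.
Qed.

(** The Bezout relation gives a point of the coset whose coordinates are powers of zeta, hence a
    torsion point when zeta is a root of unity. *)
Lemma lmon_unity a (k : 'I_n -> int) (zeta : C) : zeta != 0 ->
  \sum_i k i * a i = 1 -> lmon (fun i => zeta ^ k i) a = zeta.
Proof.
move=> z0 e; rewrite /lmon (eq_bigr (fun i => zeta ^ (k i * a i))); last first.
  by move=> i _; rewrite exprz_exp.
by rewrite prod_expz// e expr1z.
Qed.

End TorsionCoset.

Lemma bezout_bigz n (b : 'I_n -> int) :
  exists k : 'I_n -> int, \sum_i k i * b i = (\big[gcdn/0%N]_i `|b i|%N)%:Z.
Proof.
pose att (c : int) := exists k : 'I_n -> int, \sum_i k i * b i = c.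
have attM u c : att c -> att (u * c).
  move=> [k <-]; exists (fun i => u * k i); rewrite mulr_sumr.
  by apply: eq_bigr => i _; rewrite mulrA.
have attD c c' : att c -> att c' -> att (c + c').
  move=> [k <-] [k' <-]; exists (fun i => k i + k' i); rewrite -big_split.
  by apply: eq_bigr => i _; rewrite mulrDl.
rewrite -/(att _); elim/big_ind: _ => [|m m' hm hm'|i _].
- by exists (fun=> 0); rewrite big1// => i _; rewrite mul0r.
- have [u [v e]] := Bezoutz m m'.
  by have -> : (gcdn m m')%:Z = gcdz m m' by []; rewrite -e; apply: attD; apply: attM.
- have attb : att (b i).
    exists (fun j => (j == i)%:R); rewrite (bigD1 i)//= eqxx mul1r big1 ?addr0//.
    by move=> j /negbTE->; rewrite mul0r.
  by rewrite abszE normrEsg; apply: attM.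
Qed.

(** * Polynomials vanishing on the torus *)

Section VanishingOnTorus.
Variables (R : realType) (n : nat).
Local Notation C := R[i].

Lemma base_expansion_inj W m (p q : 'I_m -> nat) :
  (forall i, p i < W)%N -> (forall i, q i < W)%N ->
  (\sum_(i < m) p i * W ^ i = \sum_(i < m) q i * W ^ i)%N -> p =1 q.
Proof.
elim: m p q => [|m IH] p q hp hq; first by move=> _ [].
have split (r : 'I_m.+1 -> nat) : (\sum_(i < m.+1) r i * W ^ i =
    (\sum_(i < m) r (lift ord0 i) * W ^ i) * W + r ord0)%N.
  rewrite big_ord_recl expn0 muln1 addnC big_distrl/=; congr addn.
  by apply: eq_bigr => i _; rewrite -mulnA -expnSr.
rewrite !split => e; have W0 : (0 < W)%N by apply: leq_ltn_trans (hp ord0).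
have e0 : p ord0 = q ord0.
  by have := congr1 (modn^~ W) e; rewrite !modnMDl !modn_small.
have e1 : (\sum_(i < m) p (lift ord0 i) * W ^ i = \sum_(i < m) q (lift ord0 i) * W ^ i)%N.
  by move/eqP: e; rewrite e0 eqn_add2r eqn_pmul2r// => /eqP.
have h := IH (fun i => p (lift ord0 i)) (fun i => q (lift ord0 i))
  (fun i => hp _) (fun i => hq _) e1.
by move=> i; case: (unliftP ord0 i) => [j|] ->; [apply: h|].
Qed.

(** Kronecker substitution X_i = s^(W^i): as W exceeds all exponents of p, distinct monomials go to
    distinct powers of s, and a univariate polynomial vanishing at all s <> 0 is 0. *)
Lemma mpoly_Gm_eq0 (p : {mpoly C[n]}) : (forall x, Gm x -> p.@[x] = 0) -> p = 0.
Proof.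
move=> hp; pose W := msize p.
pose kr (m : 'X_{1..n}) := (\sum_(i < n) m i * W ^ i)%N.
pose q : {poly C} := \sum_(m <- msupp p) p@_m *: 'X^(kr m).
have qh s : s != 0 -> q.[s] = 0.
  move=> s0; rewrite -[RHS](hp (fun i : 'I_n => s ^+ (W ^ i))); last first.
    by move=> i; rewrite expf_neq0.
  rewrite mevalE /q horner_sum; apply: eq_bigr => m _; rewrite hornerZ hornerXn.
  congr (_ * _); rewrite expr_sum; apply: eq_bigr => i _.
  by rewrite -exprM mulnC.
have q0 : q = 0.
  apply: contrapT => /eqP q0.
  have : (size [seq j.+1%:R : C | j <- iota 0 (size q)] < size q)%N.
    apply: max_poly_roots => //.
      by apply/allP => _ /mapP[j _ ->]; apply/eqP/qh; rewrite pnatr_eq0.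
    by rewrite map_inj_uniq ?iota_uniq// => j j' /eqP; rewrite eqr_nat => /eqP[].
  by rewrite size_map size_iota ltnn.
have mW m : m \in msupp p -> forall i, (m i < W)%N.
  move=> mp i; apply: leq_ltn_trans (msize_mdeg_lt mp).
  by rewrite mdegE (bigD1 i)//= leq_addr.
apply/mpolyP => m; rewrite mcoeff0; apply/eqP; apply: contraT => pm.
have mp : m \in msupp p by rewrite mcoeff_msupp.
have := congr1 (fun r : {poly C} => r`_(kr m)) q0; rewrite coef0 /q coef_sum.
rewrite (bigD1_seq m)//= ?msupp_uniq// coefZ coefXn eqxx mulr1 big_seq_cond big1 ?addr0.
  by move=> e; rewrite e eqxx in pm.
move=> m' /andP[m'p ne]; rewrite coefZ coefXn.
case: eqP => [e|_]; last by rewrite mulr0.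
case/eqP: ne; apply/mnmP => i; apply/esym; move: i.
by apply: (@base_expansion_inj W); [exact: mW|exact: mW|].
Qed.
End VanishingOnTorus.

(** * Laurent polynomial functions *)

Section LaurentFunctions.
Variables (R : realType) (n : nat).
Local Notation C := R[i].
Implicit Types (F G : ('I_n -> C) -> C) (p q : {mpoly C[n]}) (t : 'I_n -> C).

Definition pdeg_le (D : nat) p := forall m, m \in msupp p -> forall i, (m i <= D)%N.

Lemma pdeg_leD D p q : pdeg_le D p -> pdeg_le D q -> pdeg_le D (p + q).
Proof. by move=> hp hq m /msuppD_le; rewrite mem_cat => /orP[/hp|/hq]. Qed.

Lemma pdeg_leM D D' p q : pdeg_le D p -> pdeg_le D' q -> pdeg_le (D + D') (p * q).
Proof.
move=> hp hq m /msuppM_le/allpairsP[[m1 m2] /= [h1 h2 ->]] i.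
by rewrite mnmDE leq_add ?hp ?hq.
Qed.

Lemma pdeg_le_mono D D' p : (D <= D')%N -> pdeg_le D p -> pdeg_le D' p.
Proof. by move=> DD hp m mp i; apply: leq_trans (hp m mp i) DD. Qed.

Lemma pdeg_leC D c : pdeg_le D c%:MP.
Proof.
move=> m mc i; suff -> : m = 0%MM by rewrite mnm0E.
by apply/eqP; apply: contraTT mc => m0; rewrite -mcoeff_eq0 mcoeffC eq_sym (negbTE m0) mulr0.
Qed.

Lemma pdeg_leX D (m : 'X_{1..n}) : (forall i, (m i <= D)%N) -> pdeg_le D 'X_[m].
Proof. by move=> hm m'; rewrite msuppX inE => /eqP->. Qed.

(* F is a Laurent polynomial function with exponents in [-K, K]. *)
Definition laurent_fun (K : nat) F : Prop := exists2 p, pdeg_le (K + K) p &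
  forall t, Gm t -> F t * (\prod_i t i) ^+ K = p.@[t].

Lemma laurent_fun_mono K K' F : (K <= K')%N -> laurent_fun K F -> laurent_fun K' F.
Proof.
move=> KK [p hp pE]; exists (p * 'X_[[multinom (K' - K)%N | i < n]]).
  have : (K + K + (K' - K) <= K' + K')%N by lia.
  move/pdeg_le_mono; apply; apply: pdeg_leM => //.
  by apply: pdeg_leX => i; rewrite mnmE.
move=> t t0; rewrite mevalM mevalX -pE// -{1}(subnKC KK) exprD mulrA; congr (_ * _).
by rewrite -prodrXl; apply: eq_bigr => i _; rewrite mnmE.
Qed.

Lemma laurent_fun_ext K F G : (forall t, Gm t -> F t = G t) ->
  laurent_fun K F -> laurent_fun K G.
Proof. by move=> FG [p hp pE]; exists p => // t t0; rewrite -FG// pE. Qed.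

Lemma laurent_funC c : laurent_fun 0 (fun=> c).
Proof. by exists c%:MP => [|t _]; [apply: pdeg_leC|rewrite mevalC expr0 mulr1]. Qed.

Lemma laurent_funD K F G : laurent_fun K F -> laurent_fun K G ->
  laurent_fun K (fun t => F t + G t).
Proof.
move=> [p hp pE] [q hq qE]; exists (p + q); first exact: pdeg_leD.
by move=> t t0; rewrite mevalD mulrDl pE// qE.
Qed.

Lemma laurent_funM K K' F G : laurent_fun K F -> laurent_fun K' G ->
  laurent_fun (K + K') (fun t => F t * G t).
Proof.
move=> [p hp pE] [q hq qE]; exists (p * q).
  by rewrite addnACA; apply: pdeg_leM.
by move=> t t0; rewrite mevalM -pE// -qE// exprD mulrACA.
Qed.

Lemma laurent_fun_prod K (I : Type) (r : seq I) (F : I -> ('I_n -> C) -> C) :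
  (forall i, laurent_fun K (F i)) ->
  laurent_fun (size r * K) (fun t => \prod_(i <- r) F i t).
Proof.
move=> hF; elim: r => [|i r IH].
  by apply: laurent_fun_ext (laurent_funC 1) => t _; rewrite big_nil.
by rewrite mulSn; apply: laurent_fun_ext (laurent_funM (hF i) IH) => t _; rewrite big_cons.
Qed.

Lemma laurent_funX K F e : laurent_fun K F -> laurent_fun (e * K) (fun t => F t ^+ e).
Proof.
move=> hF; have := @laurent_fun_prod K nat (iota 0 e) (fun=> F) (fun=> hF).
rewrite size_iota; apply: laurent_fun_ext => t _.
by rewrite big_const_seq count_predT size_iota iter_mulr_1.
Qed.

Lemma laurent_fun_lmon (b : 'I_n -> int) : exists K, laurent_fun K (fun t => lmon t b).
Proof.
pose K := (\sum_i `|b i|)%N; exists K.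
have bK i : (`|b i| <= K)%N by rewrite /K (bigD1 i)//= leq_addr.
exists 'X_[[multinom `|(b i + K%:Z)%R|%N | i < n]].
  by apply: pdeg_leX => i; rewrite mnmE; have := bK i; lia.
move=> t t0; rewrite mevalX -prodrXl -big_split; apply: eq_bigr => i _ /=.
rewrite mnmE !exprnP -expfzDr//; congr (_ ^ _).
by have := bK i; lia.
Qed.

Lemma laurent_fun_comp N (th : ('I_n -> C) -> 'I_N -> C) (f : {mpoly C[N]}) :
  (forall i, exists K, laurent_fun K (fun t => th t i)) ->
  exists K, laurent_fun K (fun t => f.@[th t]).
Proof.
move=> hth; have [K hK] := choice hth.
pose M := (\max_i K i)%N.
have hM i : laurent_fun M (fun t => th t i).
  by apply: laurent_fun_mono (hK i); apply: leq_bigmax.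
elim/mpolyind: f => [|c m p _ _ [K1 h1]].
  by exists 0%N; apply: laurent_fun_ext (laurent_funC 0) => t _; rewrite meval0.
have [K2 h2] : exists K, laurent_fun K (fun t => \prod_i th t i ^+ m i).
  pose D := (\max_i m i)%N.
  have hX i : laurent_fun (D * M) (fun t => th t i ^+ m i).
    apply: laurent_fun_mono (laurent_funX (m i) (hM i)).
    by rewrite leq_mul2r; apply/orP; right; apply: leq_bigmax.
  by exists (size (index_enum 'I_N) * (D * M))%N; apply: laurent_fun_prod.
exists (K1 + (0 + K2))%N.
apply: laurent_fun_ext (laurent_funD
  (laurent_fun_mono (leq_addl K1 _) (laurent_funM (laurent_funC c) h2))
  (laurent_fun_mono (leq_addr _ _) h1)) => t _.
by rewrite mevalD mevalZ mevalX.
Qed.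

Lemma laurent_fun_idomain K K' F G : laurent_fun K F -> laurent_fun K' G ->
  (forall t, Gm t -> F t * G t = 0) ->
  (forall t, Gm t -> F t = 0) \/ (forall t, Gm t -> G t = 0).
Proof.
move=> [p _ pE] [q _ qE] FG.
have /eqP : p * q = 0.
  by apply: mpoly_Gm_eq0 => t t0; rewrite mevalM -pE// -qE// mulrACA FG// mul0r.
have T0 t K0 : Gm t -> (\prod_i t i) ^+ K0 != 0.
  by move=> t0; rewrite expf_neq0//; apply/prodf_neq0 => i _.
rewrite mulf_eq0 => /orP[]/eqP e; [left|right] => t t0.
  by apply: (mulIf (T0 t K t0)); rewrite pE// e meval0 mul0r.
by apply: (mulIf (T0 t K' t0)); rewrite qE// e meval0 mul0r.
Qed.

(* Counting: [N ^ k] products against [(c N) ^ n] Laurent monomials. *)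
Lemma laurent_fun_dependent k K (F : 'I_k -> ('I_n -> C) -> C) : (n < k)%N ->
  (forall j, laurent_fun K (F j)) ->
  exists2 P : {mpoly C[k]}, P != 0 & forall t, Gm t -> P.@[fun j => F j t] = 0.
Proof.
move=> nk hF; pose c := (k * K + k * K).+1; pose N := (c ^ n).+1.
(* The products have exponents in [-L, L], and 2L + 1 <= c N. As N > c^n and k > n, (c N)^n <
   N^(n+1) <= N^k. *)
pose E := {ffun 'I_k -> 'I_N}; pose L := (k * (N * K))%N.
pose box := {ffun 'I_n -> 'I_(L + L).+1}.
pose me (e : E) : 'X_{1..k} := [multinom val (e j) | j < k].
pose mb (b : box) : 'X_{1..n} := [multinom val (b i) | i < n].
have hE (e : E) : exists p, pdeg_le (L + L) p /\
    forall t, Gm t -> 'X_[me e].@[fun j => F j t] * (\prod_i t i) ^+ L = p.@[t].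
  have hj j : laurent_fun (N * K) (fun t => F j t ^+ e j).
    apply: laurent_fun_mono (laurent_funX (e j) (hF j)).
    by rewrite leq_mul2r (ltnW (ltn_ord _)) orbT.
  have := laurent_fun_prod (index_enum 'I_k) hj.
  have -> : size (index_enum 'I_k) = k by rewrite -[RHS]card_ord cardE enumT.
  case=> p hp pE; exists p; split=> // t t0; rewrite -pE// mevalX.
  by congr (_ * _); apply: eq_bigr => j _; rewrite mnmE.
have [p hp] := choice hE.
have card_lt : (#|box| < #|E|)%N.
  rewrite !card_ffun !card_ord; apply: (@leq_ltn_trans ((c * N) ^ n)).
    have le1 : ((L + L).+1 <= c * N)%N.
      have -> : L = (k * K * N)%N by rewrite /L [(N * K)%N]mulnC mulnA.
      by rewrite /c mulSn mulnDl addnC -addn1 leq_add2l.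
    by case: (n) => // n'; rewrite leq_exp2r.
  apply: (@leq_trans (N ^ n.+1)); last by rewrite leq_pexp2l.
  by rewrite expnMn expnS ltn_pmul2r ?expn_gt0.
pose M : 'M[C]_(#|E|, #|box|) := \matrix_(i, j) (p (enum_val i))@_(mb (enum_val j)).
pose u := nz_row (kermx M).
have u0 : u != 0.
  rewrite nz_row_eq0 -mxrank_eq0 mxrank_ker subn_eq0 -ltnNge.
  exact: leq_ltn_trans (rank_leq_col M) card_lt.
have uM : u *m M = 0 by apply/sub_kermxP; apply: nz_row_sub.
have me_inj : injective me.
  by move=> e e' /mnmP h; apply/ffunP => j; apply: val_inj; have := h j; rewrite !mnmE.
exists (\sum_i u 0 i *: 'X_[me (enum_val i)]).
  move/rV0Pn: u0 => [i ui]; apply: contra_neq ui => /(congr1 (mcoeff (me (enum_val i)))).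
  rewrite mcoeff0 raddf_sum/= (bigD1 i)//= mcoeffZ mcoeffX eqxx mulr1 big1 ?addr0//.
  move=> i' ne; rewrite mcoeffZ mcoeffX (inj_eq me_inj) (inj_eq enum_val_inj).
  by rewrite (negbTE ne) mulr0.
move=> t t0; have T0 : (\prod_i t i) ^+ L != 0.
  by rewrite expf_neq0//; apply/prodf_neq0 => i _.
apply: (mulIf T0); rewrite mul0r.
have -> : (\sum_i u 0 i *: 'X_[me (enum_val i)]).@[fun j => F j t] * (\prod_i t i) ^+ L =
    (\sum_i u 0 i *: p (enum_val i)).@[t].
  rewrite !raddf_sum/= mulr_suml; apply: eq_bigr => i _.
  by rewrite !mevalZ -mulrA (hp _).2.
suff -> : \sum_i u 0 i *: p (enum_val i) = 0 by rewrite meval0.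
apply/mpolyP => m; rewrite mcoeff0 raddf_sum/=.
have [mL|mL] := pselect (forall i, (m i <= L + L)%N).
  pose b : box := [ffun i => inord (m i)].
  have mE : mb b = m by apply/mnmP => i; rewrite mnmE ffunE /= inordK// ltnS.
  have := congr1 (fun A : 'rV_ #|box| => A 0 (enum_rank b)) uM.
  rewrite !mxE => e; rewrite -[RHS]e; apply: eq_bigr => i _.
  by rewrite mcoeffZ mxE enum_rankK mE.
apply: big1 => i _; rewrite mcoeffZ; apply/eqP; rewrite mulf_eq0; apply/orP; right.
rewrite mcoeff_eq0; apply/negP => mp; move/existsNP: mL => [j]; apply.
exact: (hp (enum_val i)).1 mp j.
Qed.
End LaurentFunctions.

(** * Monomial parametrization and dimension *)

Section Parametrization.
Variables (R : realType) (n : nat) (a k : 'I_n.+1 -> int) (i0 : 'I_n.+1).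
Local Notation C := R[i].
Hypothesis ai0 : a i0 != 0.
Hypothesis bez : \sum_i k i * a i = 1.

Lemma expz_root (b : int) (c : C) : b != 0 -> c != 0 -> exists2 r, r != 0 & r ^ b = c.
Proof.
move=> b0 c0; have pos m d : (0 < m)%N -> d != 0 -> exists2 r : C, r != 0 & r ^+ m = d.
  move=> m0 d0; exists (m.-root d); last exact: rootCK.
  by rewrite rootC_eq0.
case: b b0 => m m0; first by apply: pos => //; rewrite lt0n.
have [r r0 e] := pos m.+1 c^-1 isT (invr_neq0 c0).
by exists r => //; rewrite NegzE -invr_expz -exprnP e invrK.
Qed.

(** A finite-to-one monomial map onto the subgroup x^a = 1. It serves as parametrization without
    completing a to a basis of the lattice. *)
Definition theta (t : 'I_n -> C) (i : 'I_n.+1) : C :=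
  if unlift i0 i is Some j then t j ^ a i0 else \prod_j t j ^ (- a (lift i0 j)).

Lemma theta_lift t j : theta t (lift i0 j) = t j ^ a i0.
Proof. by rewrite /theta liftK. Qed.

Lemma theta_i0 t : theta t i0 = \prod_j t j ^ (- a (lift i0 j)).
Proof. by rewrite /theta unlift_none. Qed.

Lemma lmon_lift (x : 'I_n.+1 -> C) :
  lmon x a = x i0 ^ a i0 * \prod_j x (lift i0 j) ^ a (lift i0 j).
Proof. by rewrite /lmon (bigD1_ord i0). Qed.

Lemma theta_Gm t : Gm t -> Gm (theta t).
Proof.
move=> t0 i; rewrite /theta; case: unliftP => [j|] _; first by rewrite expfz_neq0.
by apply/prodf_neq0 => j _; rewrite expfz_neq0.
Qed.

Lemma theta_tcoset t : Gm t -> tcoset a 1 (theta t).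
Proof.
move=> t0; split; first exact: theta_Gm.
rewrite lmon_lift theta_i0 expz_prod -big_split big1// => j _ /=.
by rewrite theta_lift !exprz_exp -expfzDr// mulNr mulrC addNr.
Qed.

(* Extract [a i0]-th roots of the other coordinates; the discrepancy at [i0] is a root of unity
   xi, which the Bezout relation for the primitive vector a distributes over the roots. *)
Lemma theta_surj x : tcoset a 1 x -> exists2 t, Gm t & theta t = x.
Proof.
move=> [x0 hx]; have ex j : exists r, r != 0 /\ r ^ a i0 = x (lift i0 j).
  by have [r] := expz_root ai0 (x0 (lift i0 j)); exists r.
have [r hr] := choice ex.
have r0 : Gm r by move=> j; have [] := hr j.
pose y := \prod_j r j ^ (- a (lift i0 j)).
have y0 : y != 0 by apply/prodf_neq0 => j _; rewrite expfz_neq0.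
pose xi := x i0 / y; have xi0 : xi != 0 by rewrite mulf_neq0 ?invr_eq0.
have xi1 : xi ^ a i0 = 1.
  rewrite expfzMl exprz_inv -invr_expz; apply: (mulIf (expfz_neq0 (a i0) y0)).
  rewrite mulfVK ?expfz_neq0// mul1r /y expz_prod.
  apply: (mulIf (_ : \prod_j x (lift i0 j) ^ a (lift i0 j) != 0)).
    by apply/prodf_neq0 => j _; rewrite expfz_neq0.
  rewrite -lmon_lift hx -big_split big1// => j _ /=; have [_ <-] := hr j.
  by rewrite !exprz_exp -expfzDr// mulNr mulrC addNr.
exists (fun j => r j * xi ^ (- k (lift i0 j))).
  by move=> j; rewrite mulf_neq0 ?expfz_neq0.
apply/funext => i; case: (unliftP i0 i) => [j|] ->.
  rewrite theta_lift expfzMl [(xi ^ _) ^ _]exprz_exp [- _ * a i0]mulrC.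
  rewrite -[xi ^ (a i0 * _)]exprz_exp xi1 exp1rz mulr1.
  by have [] := hr j.
rewrite theta_i0 (eq_bigr (fun j => r j ^ (- a (lift i0 j)) *
   xi ^ (k (lift i0 j) * a (lift i0 j)))); last first.
  by move=> j _; rewrite expfzMl exprz_exp mulrNN.
rewrite big_split/= prod_expz//.
have -> : \sum_j k (lift i0 j) * a (lift i0 j) = 1 - a i0 * k i0.
  by rewrite -bez (bigD1_ord i0)//= mulrC addrAC subrr add0r.
by rewrite expfzDr// expr1z -invr_expz -exprz_exp xi1 exp1rz invr1 mulr1 mulrC divfK.
Qed.

Lemma theta_laurent i : exists K, laurent_fun K (fun t => theta t i).
Proof.
case: (unliftP i0 i) => [j|] ->; last first.
  have [K hK] := @laurent_fun_lmon R n (fun j => - a (lift i0 j)).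
  by exists K; apply: laurent_fun_ext hK => t _; rewrite theta_i0.
have [K hK] := @laurent_fun_lmon R n (fun j' => if j' == j then a i0 else 0).
exists K; apply: laurent_fun_ext hK => t _; rewrite theta_lift /lmon (bigD1 j)//= eqxx.
by rewrite big1 ?mulr1// => j' /negbTE->; rewrite expr0z.
Qed.

(** Pulled back along [theta], equations of A and B that fail somewhere on the subgroup become
    nonzero Laurent functions with product 0. *)
Lemma tcoset1_irreducible : irreducible_set (tcoset (R := R) a 1).
Proof.
split; first by exists (@pt1 R n.+1); have [] := tcoset_subgroup R a.
move=> _ _ [FA ->] [FB ->] WAB.
have [|/existsNP[x1 /not_implyP[W1 nA]]] := pselect (tcoset a 1 `<=` Zset FA); first by left.
have [|/existsNP[x2 /not_implyP[W2 nB]]] := pselect (tcoset a 1 `<=` Zset FB); first by right.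
have wit (F : set {mpoly C[n.+1]}) x : tcoset a 1 x -> ~ Zset F x -> exists2 f, F f & f.@[x] <> 0.
  move=> [x0 _] nF; apply: contrapT => nex; apply: nF; split=> // f Ff.
  by apply: contrapT => nf; apply: nex; exists f.
have [f Ff fx] := wit _ _ W1 nA; have [g Fg gx] := wit _ _ W2 nB.
have [K1 h1] := laurent_fun_comp f theta_laurent.
have [K2 h2] := laurent_fun_comp g theta_laurent.
have [t1 t10 e1] := theta_surj W1; have [t2 t20 e2] := theta_surj W2.
have [t t0|h|h] := laurent_fun_idomain h1 h2.
- have [[_ /(_ _ Ff)->]|[_ /(_ _ Fg)->]] := WAB _ (theta_tcoset t0); by rewrite ?mul0r ?mulr0.
- by case: fx; rewrite -e1 h.
- by case: gx; rewrite -e2 h.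
Qed.

Lemma tcoset_torsion_coset (zeta : C) m : (0 < m)%N -> zeta ^+ m = 1 ->
  torsion_coset (tcoset a zeta).
Proof.
move=> m0 zm; have z0 : zeta != 0.
  by apply: contra_eq_neq zm => ->; rewrite expr0n gtn_eqF// eq_sym oner_neq0.
exists (fun i => zeta ^ k i), (tcoset a 1); split.
- by move=> i; exists m => //; apply/unity_rootP; apply: unity_expz.
- by split; [exact: tcoset_subgroup|exact: tcoset1_irreducible].
- apply: tcoset_translate; last exact: lmon_unity.
  by move=> i; rewrite expfz_neq0.
Qed.

(** The coordinates other than [i0] take all nonzero values, the one at [i0] then being found as a
    root, so they are independent. More than n functions pull back to dependent Laurent functions of
    n variables. *)
Lemma tcoset_has_dim (zeta : C) : zeta != 0 -> has_dim (tcoset a zeta) n.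
Proof.
move=> z0; split.
  exists (fun j => 'X_(lift i0 j)) => P hP; apply: mpoly_Gm_eq0 => t t0.
  pose A := \prod_j t j ^ a (lift i0 j).
  have A0 : A != 0 by apply/prodf_neq0 => j _; rewrite expfz_neq0.
  have [r r0 hr] := expz_root ai0 (mulf_neq0 z0 (invr_neq0 A0)).
  pose x i := if unlift i0 i is Some j then t j else r.
  have xl j : x (lift i0 j) = t j by rewrite /x liftK.
  have x_i0 : x i0 = r by rewrite /x unlift_none.
  rewrite -(hP x); first by apply: meval_eq => j; rewrite mevalXU xl.
  split; first by move=> i; rewrite /x; case: unliftP.
  rewrite lmon_lift x_i0 hr (eq_bigr (fun j => t j ^ a (lift i0 j))).
    by rewrite divfK.
  by move=> j _; rewrite xl.
move=> m g gind; rewrite leqNgt; apply/negP => nm.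
pose w i : C := zeta ^ k i.
have w0 : Gm w by move=> i; rewrite expfz_neq0.
have wa : lmon w a = zeta by apply: lmon_unity.
have hw i : exists K, laurent_fun K (fun t => ptmul w (theta t) i).
  have [K hK] := theta_laurent i; exists (0 + K)%N.
  exact: laurent_funM (laurent_funC _ _) hK.
have [K hK] := choice (fun j => laurent_fun_comp (g j) hw).
pose M := (\max_j K j)%N.
have hM j : laurent_fun M (fun t => (g j).@[ptmul w (theta t)]).
  by apply: laurent_fun_mono (hK j); apply: leq_bigmax.
have [P P0 hP] := laurent_fun_dependent nm hM.
case/eqP: P0; apply: gind => x; rewrite (tcoset_translate w0 wa) => -[y /theta_surj[t t0 <-] <-].
exact: hP.
Qed.
End Parametrization.

(** * Effective constants and the finite covering *)

Lemma computable3_mul F : computable3 F -> computable3 (fun z n d => n * F z n d)%N.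
Proof.
move=> [f hf]; have hF : recursive 3 (fun v => F (nth 0 v 0) (nth 0 v 1) (nth 0 v 2))%N.
  exists f => v; have := hf (nth 0 v 0)%N (nth 0 v 1)%N (nth 0 v 2)%N.
  congr (Defs.rgraph f _ _); apply: val_inj => /=.
  by case/tupleP: v => b v; case/tupleP: v => c v; case/tupleP: v => d v; rewrite tuple0.
have [g hg] := recursive_mul (@recursive_var 3 1 isT) hF.
by exists g => b c d; apply: (hg [tuple b; c; d]).
Qed.

(** Two of the m + 1 residues of z^0, ..., z^m modulo m coincide. This turns m-th roots of unity
    into roots of the required order. *)
Lemma power_preperiodic z m : (0 < z)%N -> (0 < m)%N ->
  exists k l, [/\ (0 < l)%N, (k <= m)%N, (l <= m)%N & (m %| z ^ k * (z ^ l - 1))%N].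
Proof.
move=> z0 m0; pose s := [seq (z ^ i %% m)%N | i <- iota 0 m.+1].
have ss : size s = m.+1 by rewrite size_map size_iota.
have /(uniqPn 0%N)[k1 [k2 [k12]]] : ~~ uniq s.
  apply/negP => us; suff : (m.+1 <= m)%N by rewrite ltnn.
  rewrite -{1}ss -[X in (_ <= X)%N](size_iota 0 m); apply: uniq_leq_size us _.
  by move=> w /mapP[t _ ->]; rewrite mem_iota ltn_pmod.
rewrite ss => k2m; rewrite !(nth_map 0%N) ?size_iota ?(ltn_trans k12)//.
rewrite !nth_iota ?(ltn_trans k12)// !add0n => e.
exists k1, (k2 - k1)%N; split; [by rewrite subn_gt0|by lia|by lia|].
rewrite mulnBr muln1 -expnD subnKC ?(ltnW k12)//.
by rewrite -eqn_mod_dvd ?leq_pexp2l ?(ltnW k12)//; apply/eqP.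
Qed.

Section Roots.
Variable R : realType.
Lemma unity_roots_list (m : nat) : (0 < m)%N ->
  exists rs : seq R[i], forall zeta, zeta ^+ m = 1 -> zeta \in rs.
Proof.
move=> m0; have [rs e] := closed_field_poly_normal ('X^m - 1 : {poly R[i]}).
have l0 : lead_coef ('X^m - 1 : {poly R[i]}) != 0.
  by rewrite lead_coef_eq0 -size_poly_eq0 size_XnsubC.
exists rs => zeta zm; have : root ('X^m - 1) zeta by rewrite /root !hornerE zm subrr.
by rewrite e rootZ// root_prod_XsubC.
Qed.

Lemma bounded_unity_roots (B : nat) : exists rs : seq R[i], forall m zeta,
  (0 < m <= B)%N -> zeta ^+ m = 1 -> zeta \in rs.
Proof.
elim: B => [|B [rs hrs]]; first by exists [::] => m zeta; lia.
have [rs' hrs'] := unity_roots_list (ltn0Sn B).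
exists (rs ++ rs') => m zeta /andP[m0]; rewrite leq_eqVlt mem_cat => /orP[/eqP->|mB] zm.
  by rewrite hrs' ?orbT.
by rewrite (hrs m)// m0.
Qed.

Lemma norm2_le n (a : 'I_n -> int) B : (0 < n)%N -> (forall i, (`|a i| <= B)%N) ->
  norm2 R a <= (n * B)%N%:R.
Proof.
move=> n0 aB; rewrite -[X in _ <= X]ger0_norm// -sqrtr_sqr ler_sqrt ?sqr_ge0//.
apply: (@le_trans _ _ (\sum_(i < n) B%:R ^+ 2)).
  apply: ler_sum => i _; rewrite -[X in X <= _]real_normK ?num_real// -intr_norm.
  by rewrite lerXn2r ?nnegrE ?ler0z// -abszE -pmulrn ler_nat.
rewrite sumr_const card_ord -[_ *+ n]mulr_natl natrM exprMn ler_wpM2r ?sqr_ge0//.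
by rewrite -natrX ler_nat leq_pmulr.
Qed.
End Roots.

(** With g the content of u - v, the relation only says that x^a is a g-th root of unity; this value
    is the zeta of the coset, and g <= B. Primitivity of a is recorded by the Bezout coefficients
    k. *)
Lemma primitive_part (R : realType) n (x : 'I_n -> R[i]) (u v : 'I_n -> nat) B :
  Gm x -> (forall i, (u i <= B)%N /\ (v i <= B)%N) -> (exists i, u i != v i) ->
  \prod_i x i ^+ u i = \prod_i x i ^+ v i ->
  exists (a k : 'I_n -> int) (m : nat), [/\ \sum_i k i * a i = 1,
    forall i, (`|a i| <= B)%N, (0 < m <= B)%N & (lmon x a) ^+ m = 1].
Proof.
move=> x0 uvB [i1 ne] e; pose b i : int := (u i)%:Z - (v i)%:Z.
pose g := (\big[gcdn/0%N]_i `|b i|)%N.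
have gb i : (g %| `|b i|)%N by rewrite /g (bigD1 i)//= dvdn_gcdl.
have b1 : (0 < `|b i1|)%N by rewrite absz_gt0 subr_eq0; apply: contra ne => /eqP[->].
have bB i : (`|b i| <= B)%N by have [] := uvB i; rewrite /b; lia.
have g0 : (0 < g)%N by apply: dvdn_gt0 b1 (gb i1).
have gB : (g <= B)%N by apply: leq_trans (dvdn_leq b1 (gb i1)) (bB i1).
have gz0 : g%:Z != 0 by rewrite eqz_nat -lt0n.
pose a i : int := (b i %/ g%:Z)%Z.
have ab i : b i = a i * g%:Z by rewrite divzK// dvdzE.
have [k hk] := bezout_bigz b.
exists a, k, g; split.
- apply: (mulIf gz0); rewrite mul1r mulr_suml -[RHS]hk; apply: eq_bigr => i _.
  by rewrite -mulrA -ab.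
- move=> i; apply: leq_trans (bB i); rewrite ab abszM leq_pmulr//.
- by rewrite g0.
- have -> : lmon x a ^+ g = \prod_i x i ^+ u i / \prod_i x i ^+ v i.
    rewrite -prodf_div exprnP expz_prod; apply: eq_bigr => i _.
    by rewrite exprz_exp -ab expfzDr// -invr_expz.
  by rewrite e divff//; apply/prodf_neq0 => i _; rewrite expf_neq0.
Qed.

Lemma tcoset_torsion_hypersurface (R : realType) n (a k : 'I_n -> int) (zeta : R[i]) m :
  (0 < n)%N -> (0 < m)%N -> zeta ^+ m = 1 -> \sum_i k i * a i = 1 ->
  [/\ torsion_coset (tcoset a zeta), has_dim (tcoset a zeta) n.-1 & exists i, a i != 0].
Proof.
case: n a k => // n a k _ m0 zm hk.
have [i0 ai0] : exists i0, a i0 != 0.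
  apply: contrapT => /forallNP a0; suff : (0 : int) = 1 by [].
  rewrite -hk big1// => i _; have /negP := a0 i; rewrite negbK => /eqP->.
  by rewrite mulr0.
have zeta0 : zeta != 0.
  by apply: contra_eq_neq zm => ->; rewrite expr0n gtn_eqF// eq_sym oner_neq0.
split; last by exists i0.
  exact: (tcoset_torsion_coset ai0 hk m0 zm).
exact: (tcoset_has_dim ai0 hk zeta0).
Qed.

Theorem theorem1 (R : realType) :
  exists T E L : nat -> nat -> nat -> nat,
    [/\ computable3 T, computable3 E, computable3 L &
    forall z n d : nat, (2 <= z)%N -> (0 < n)%N -> (0 < d)%N ->
    forall (s : nat) (f : 'I_s -> {mpoly R[i][n]}),
      (* msize is the total degree plus one, and 0 for the zero polynomial *)
      (forall j, (msize (f j) <= d.+1)%N) ->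
    let V := Zset (range f) in
    exists S : set ('I_n -> R[i]),
      [/\ unique (maximal_stable z V) S,
          S = Vzu V z (T z n d)
        & V <> Gm ->
          exists (N : nat) (D : 'I_N -> set ('I_n -> R[i])),
            (forall i : 'I_N,
               [/\ torsion_coset (D i), has_dim (D i) n.-1 &
                exists h (a : 'I_n -> int) (zeta : R[i]) (k l : nat),
                  [/\ D i = laurent_zeros h,
                      laurent_sim h (lmonomial R a - lconst n zeta),
                      norm2 R a <= (L z n d)%:R,
                      ((z ^ k * (z ^ l - 1))%N).-unity_root zeta
                    & [/\ (0 < l)%N, (k <= E z n d)%N & (l <= E z n d)%N]]]) /\
            S `<=` \bigcup_(i in [set: 'I_N]) D i]].
Proof.
(* E is the bound on the order m, as k, l <= m. L uses n B instead of sqrt(n) B to remain a natural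
   number. *)
exists stab_time, relation_bound, (fun z n d => n * relation_bound z n d)%N.
split; first exact: stab_time_computable.
- exact: relation_bound_computable.
- exact/computable3_mul/relation_bound_computable.
move=> z n d z2 n0 d0 s f fd V; have z0 := ltnW z2.
exists (Vzu V z (stab_time z n d)); split=> //; first exact: unique_maximal_stable.
move=> VG; set B := relation_bound z n d.
have [j [x0 fx0]] : exists j x0, (f j).@[x0] != 0.
  apply: contrapT => nex; apply: VG; apply/seteqP; split=> x; first by case.
  move=> xG; split=> // _ [j _ <-]; apply/eqP; apply: contraT => fx.
  by case: nex; exists j, x.
have [rs hrs] := bounded_unity_roots R B.
(* The shift by B codes vectors with entries in [-B, B] by a finite type. The cosets listed are
   those of all primitive such vectors and all roots of unity of order at most B, so one family
   serves every V with the same z, n, d. *)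
pose vec (e : {ffun 'I_n -> 'I_(B + B).+1}) (i : 'I_n) : int := (e i)%:Z - B%:Z.
pose good (p : {ffun 'I_n -> 'I_(B + B).+1} * R[i]) := `[<
  (exists k, \sum_i k i * vec p.1 i = 1) /\ exists2 m, (0 < m <= B)%N & p.2 ^+ m = 1 >].
pose l := [seq p <-
  [seq (e, zeta) | e <- enum {: {ffun 'I_n -> 'I_(B + B).+1}}, zeta <- rs] | good p].
pose p0 : {ffun 'I_n -> 'I_(B + B).+1} * R[i] := ([ffun=> ord0], 0).
exists (size l), (fun i => tcoset (vec (nth p0 l i).1) (nth p0 l i).2); split.
- move=> i; have : nth p0 l i \in l by apply: mem_nth.
  case: (nth p0 l i) => e zeta /=; rewrite mem_filter.
  move=> /andP[/asboolP[[k hk] [m /andP[m0 mB] zm]] _].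
  rewrite /= in hk zm; set a := vec e in hk *.
  have [tc hd a0] := tcoset_torsion_hypersurface n0 m0 zm hk; split=> //.
  have [k' [l' [l0 km lm dv]]] := power_preperiodic z0 m0.
  exists (lmonomial R a - lconst n zeta), a, zeta, k', l'; split.
  + by rewrite laurent_zeros_binomial.
  + exact: laurent_sim_refl.
  + apply: norm2_le => // i'; rewrite /a /vec; have := ltn_ord (e i'); lia.
  + by apply/unity_rootP; move/dvdnP: dv => [q ->]; rewrite mulnC exprM zm expr1n.
  + by split=> //; [apply: leq_trans km mB|apply: leq_trans lm mB].
- move=> x xS; have xG : Gm x by case: xS.
  have orb t : (f j).@[power_map (z ^ t) x] = 0.
    have := Vzu_stab_time_sub z0 fd t xS; case=> _ /(_ t (leqnn t))[_].
    by rewrite iter_power_map; apply; exists j.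
  have [u [v [uvB ne e]]] := mpoly_orbit_relation z2 (fd j) fx0 xG orb.
  have [a [k [m [hk aB mB xm]]]] := primitive_part xG uvB ne e.
  pose ea : {ffun 'I_n -> 'I_(B + B).+1} := [ffun i => inord `|(a i + B%:Z)%R|%N].
  have vecE : vec ea = a.
    apply/funext => i; rewrite /vec ffunE inordK; have := aB i; rewrite -/B; lia.
  have inl : (ea, lmon x a) \in l.
    rewrite mem_filter; apply/andP; split.
      by apply/asboolP; rewrite /= vecE; split; [exists k|exists m].
    apply/allpairsP; exists (ea, lmon x a); split=> //=; first by rewrite mem_enum.
    exact: hrs mB xm.
  have il : (index (ea, lmon x a) l < size l)%N by rewrite index_mem.
  by exists (Ordinal il) => //=; rewrite nth_index//= vecE.
Qed.
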